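(* Consider the problem of minimizing $F(x)=\mathbb{E}[f_\omega(x)]$ over $x\in\mathbb{X}$ subject to $G^i(x)=\mathbb{E}[g^i_\omega(x)]\le 0$, $i=1,\dots,m$, and suppose the following hold: (a) all subgradients of $F$ and $G^i$ are bounded: $\|\nabla F(x)\|\le C_F$ and $\|\nabla G^i(x)\|\le C_G^i$ for each $i=1,\dots,m$ and all $x\in\mathbb{X}$; (b) $\mathbb{E}\|\nabla f_\omega(x)-\mathbb{E}[\nabla f_\omega(x)]\|^2\le\sigma_F^2$ and $\mathbb{E}\|\nabla g^i_\omega(x)-\mathbb{E}[\nabla g^i_\omega(x)]\|^2\le[\sigma_G^i]^2$ for each $i$ and all $x\in\mathbb{X}$; (c) $\mathbb{E}|g^i_\omega(x)|^2\le[D_G^i]^2$ for each $i$ and all $x\in\mathbb{X}$; (d) the Lagrangian $\mathcal{L}(x,z)=F(x)+z^\top G(x)$ admits a saddle point $(x_\star,z_\star)\in\mathbb{X}\times\mathbb{R}^m_+$. Let $\{\gamma_k\}_{k=1}^\infty$ be a positive sequence with $\sum_{k=1}^\infty\gamma_k=\infty$ and $\sum_{k=1}^\infty\gamma_k^2<\infty$. Then, almost surely, the sequence $(x_k,z_k)$ generated by the primal-dual stochastic subgradient method (defined in the context) with step sizes $\gamma_k$ remains bounded and $$\lim_{k\to\infty}\big[\mathcal{L}(x_k,z_\star)-\mathcal{L}(x_\star,z_k)\big]=0.$$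
   Context: Setting. $\omega\in\Omega$ is random; $\mathbb{X}\subseteq\mathbb{R}^n$ is a closed convex set; the real-valued functions $f_\omega,g^1_\omega,\dots,g^m_\omega$ are convex (not necessarily differentiable) over $\mathbb{X}$, and $\mathbb{E}|f_\omega(x)|$, $\mathbb{E}|g^i_\omega(x)|$ are finite for every $x\in\mathbb{X}$. Write $G=(G^1,\dots,G^m)$, $g_\omega=(g^1_\omega,\dots,g^m_\omega)$. $\|\cdot\|$ is the Euclidean norm, $\mathbb{R}_+$ the set of nonnegative reals. For a convex function $h$, $\nabla h(x)$ denotes a subgradient of $h$ at $x$; in the algorithm the subgradients of $f_\omega$ and $g^i_\omega$ may be arbitrary elements of their subdifferentials, which are assumed nonempty everywhere in $\mathbb{X}$. A point $(x_\star,z_\star)\in\mathbb{X}\times\mathbb{R}^m_+$ is a saddle point of $\mathcal{L}$ if $\mathcal{L}(x_\star,z)\le\mathcal{L}(x_\star,z_\star)\le\mathcal{L}(x,z_\star)$ for all $(x,z)\in\mathbb{X}\times\mathbb{R}^m_+$. Primal-dual stochastic subgradient method. Choose $x_1\in\mathbb{X}$, $z_1=0\in\mathbb{R}^m$ and a positive sequence $(\gamma_k)$. All samples $\omega_1,\omega_{1+1/2},\omega_2,\omega_{2+1/2},\dots$ are independent and identically distributed according to the law of $\omega$. For $k\ge1$: sample $\omega_k$ and set $$x_{k+1}=\operatorname*{argmin}_{x\in\mathbb{X}}\Big\langle\nabla f_{\omega_k}(x_k)+\sum_{i=1}^m z_k^i\nabla g^i_{\omega_k}(x_k),\,x-x_k\Big\rangle+\frac{1}{2\gamma_k}\|x-x_k\|^2;$$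 then sample $\omega_{k+1/2}$ and set $$z_{k+1}=\operatorname*{argmax}_{z\in\mathbb{R}^m_+}\langle g_{\omega_{k+1/2}}(x_{k+1}),\,z-z_k\rangle-\frac{1}{2\gamma_k}\|z-z_k\|^2.$$ *)

(* Defs.v *)
From mathcomp Require Import all_boot all_order all_algebra finmap.
From mathcomp Require Import all_classical all_reals all_analysis.

Set Implicit Arguments.
Unset Strict Implicit.
Unset Printing Implicit Defensive.

Import Order.TTheory GRing.Theory Num.Theory.
Import numFieldNormedType.Exports.

Local Open Scope classical_set_scope.
Local Open Scope ring_scope.

Section euclidean.
Context {R : realType} {n : nat}.
Implicit Types u v : 'cV[R]_n.

Definition dot u v : R := \sum_(i < n) u i 0 * v i 0.

(* The norm `|u| of the library on matrices is the sup norm. *)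
Definition enorm u : R := Num.sqrt (dot u u).

Definition orthant : set 'cV[R]_n := [set u | forall i, 0 <= u i 0].

Definition subdifferential (D : set 'cV[R]_n) (h : 'cV[R]_n -> R) (x : 'cV[R]_n) :
  set 'cV[R]_n := [set s | forall y, D y -> h x + dot s (y - x) <= h y].

Definition borel_cV := g_sigma_algebraType (@open 'cV[R]_n).

End euclidean.
Arguments borel_cV : clear implicits.

Definition is_argmin {R : realType} {V : Type} (A : set V) (h : V -> R) (a : V) :=
  A a /\ forall b, A b -> h a <= h b.

Definition is_argmax {R : realType} {V : Type} (A : set V) (h : V -> R) (a : V) :=
  A a /\ forall b, A b -> h b <= h a.

Section expectations.
Context {d : measure_display} {Om : measurableType d} {R : realType}.
Variable P : probability Om R.

(* The function x |-> E[h_w(x)], meaningful where h_w(x) is integrable. *)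
Definition mean {V : Type} (h : Om -> V -> R) (x : V) : R :=
  fine 'E_P[fun w => h w x].

(* Whatever value [fine] gives to a non-integrable coordinate, the bound
   [variance_le] makes v square-integrable, so that the mean is a genuine one. *)
Definition mean_cV {n : nat} (v : Om -> 'cV[R]_n) : 'cV[R]_n :=
  \col_(j < n) fine 'E_P[fun w => v w j 0].

Definition variance_le {n : nat} (v : Om -> 'cV[R]_n) (s : R) :=
  ('E_P[fun w => (enorm (v w - mean_cV v) ^+ 2)%R] <= (s ^+ 2)%:E)%E.

End expectations.

Section independence.
Context {d d' : measure_display} {T : measurableType d} {Om : measurableType d'}.
Context {R : realType}.
Variable Q : probability T R.

Definition mutually_independent {I : choiceType} (X : I -> {RV Q >-> Om}) :=
  forall (J : {fset I}) (A : I -> set Om),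
    (forall i, i \in J -> measurable (A i)) ->
    Q (\bigcap_(i in [set` J]) (X i @^-1` A i)) =
      (\prod_(i <- J) Q (X i @^-1` A i))%E.

(* w k and w' k stand for the samples of index k+1 and k+1+1/2 of the method,
   whose iterations are numbered from 1. *)
Definition iid_samples (P : probability Om R) (w w' : nat -> {RV Q >-> Om}) :=
  [/\ mutually_independent
        (fun j : nat + nat => match j with inl k => w k | inr k => w' k end),
      forall k A, measurable A -> distribution Q (w k) A = P A &
      forall k A, measurable A -> distribution Q (w' k) A = P A].

End independence.

Section lagrangian.
Context {R : realType} {n m : nat}.
Variables (F : 'cV[R]_n -> R) (G : 'I_m -> 'cV[R]_n -> R).

Definition lagrangian (x : 'cV[R]_n) (z : 'cV[R]_m) : R :=
  F x + dot z (\col_i G i x).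

Definition saddle_point (X : set 'cV[R]_n) (xs : 'cV[R]_n) (zs : 'cV[R]_m) :=
  [/\ X xs, orthant zs &
      forall x z, X x -> orthant z ->
        lagrangian xs z <= lagrangian xs zs <= lagrangian x zs].

End lagrangian.

Section algorithm.
Context {R : realType} {n m : nat} {Om : Type}.

(* df and dg are the subgradients returned by the oracle.
   Index k stands for the iteration k+1 of the method, so that x 0 = x_1. *)
Definition primal_dual_run (X : set 'cV[R]_n) (g : 'I_m -> Om -> 'cV[R]_n -> R)
    (df : Om -> 'cV[R]_n -> 'cV[R]_n) (dg : 'I_m -> Om -> 'cV[R]_n -> 'cV[R]_n)
    (gamma : nat -> R) (x1 : 'cV[R]_n) (w w' : nat -> Om)
    (x : nat -> 'cV[R]_n) (z : nat -> 'cV[R]_m) :=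
  [/\ x 0%N = x1, z 0%N = 0 &
  forall k,
    is_argmin X
      (fun y => dot (df (w k) (x k) + \sum_(i < m) z k i 0 *: dg i (w k) (x k))
                    (y - x k)
                + (2 * gamma k)^-1 * enorm (y - x k) ^+ 2) (x k.+1) /\
    is_argmax orthant
      (fun y => dot (\col_i g i (w' k) (x k.+1)) (y - z k)
                - (2 * gamma k)^-1 * enorm (y - z k) ^+ 2) (z k.+1)].

End algorithm.

Section data.
Context {d : measure_display} {Om : measurableType d} {R : realType} {n : nat}.
Variable P : probability Om R.

(* D is the domain of the random convex functions: they are convex and
   integrable on D, and subgradients are tested against the points of D.  For
   D = X these are the subgradients relative to X; as these include the normal
   vectors of X, they can all be bounded only if X is the whole space.  For
   functions defined beyond X, take a larger D, such as the whole space. *)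
Definition random_convex (D : set 'cV[R]_n) (h : Om -> 'cV[R]_n -> R) :=
  (forall w, @convex_function R 'cV[R]_n D (h w)) /\
  (forall x, D x -> P.-integrable [set: Om] (EFin \o h ^~ x)).

(* Joint measurability of what is evaluated at the random iterates, without
   which they need not be random variables. *)
Definition jointly_measurable (X : set 'cV[R]_n) (h : Om -> 'cV[R]_n -> R) :=
  measurable_fun ([set: Om] `*` X : set (Om * borel_cV R n))
    (fun p : Om * borel_cV R n => h p.1 p.2).

Definition subgradient_oracle (D X : set 'cV[R]_n) (h : Om -> 'cV[R]_n -> R)
    (dh : Om -> 'cV[R]_n -> 'cV[R]_n) :=
  (forall w x, X x -> subdifferential D (h w) x (dh w x)) /\
  (forall j, jointly_measurable X (fun w x => dh w x j 0)).

End data.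

(* Main.v *)
(* Let Y_k = 1 + |x_k - xs|^2 + |z_k - zs|^2 and a_k = L(x_k, zs) - L(xs, z_k) >= 0.
   Freezing the past in the two half-steps (Fubini, by independence of the
   samples), the usual projection estimates give, for every nonnegative weight
   phi depending on the past only,
     E[phi Y_{k+1}] + 2 g_k E[phi a_k] <= (1 + K g_k^2) E[phi Y_k],
   where g_k is the step size.  Normalised by the products of the 1 + K g_k^2,
   Y_k is a nonnegative supermartingale: it is bounded almost surely by the
   maximal inequality, and the series of the g_k E[a_k] converges.

   The gap is Lipschitz, so |a_{k+1} - a_k| <= L g_k N_k, where N_k is the sum of
   the norms of the stochastic subgradient and constraint, with conditional
   second moment at most K Y_k.  Weighting by (g_k a_k + g_k^2) / Y_k shows, with
   first moments only, that the series of g_k a_k, g_k a_k N_k and g_k^2 N_k^2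
   converge almost surely.  Hence the a_k^2 have bounded variation and converge;
   the limit is 0 because the series of the g_k diverges. *)
Require Import Defs.
From mathcomp Require Import all_boot all_order all_algebra finmap.
From mathcomp Require Import all_classical all_reals all_analysis.
From mathcomp Require Import unstable measurable_realfun.
From mathcomp Require Import ring lra.

Set Implicit Arguments.
Unset Strict Implicit.
Unset Printing Implicit Defensive.

Import Order.TTheory GRing.Theory Num.Theory.
Import numFieldNormedType.Exports.

Local Open Scope classical_set_scope.
Local Open Scope ring_scope.

(** * Euclidean geometry and proximal steps *)

Section euclidean_space.
Context {R : realType} {n : nat}.
Implicit Types (u v y a b : 'cV[R]_n) (c : R).

(** Conditional expectations are replaced by inequalities between extended-real integrals of
    nonnegative functions, tested against weights measurable for the past; the past is a smaller
    sigma-algebra on [T] itself. Integrability of the energy is not presupposed, so integrals are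
    added but never subtracted. The iterates are given only as minimisers, outcome by outcome. They
    are measurable because a proximal step is a nonexpansive function of the point it projects. The
    dual half-step samples the constraint at the new primal point, whereas the gap a_k involves the
    old one. The Lipschitz bound on G, together with a primal step of length at most g_k times the
    norm of the direction, makes the discrepancy a term of order g_k^2. The weight is divided by Y_k
    because the conditional second moment of the noise may grow like Y_k: without the division,
    E[g_k a_k N_k^2] would call for a bound on E[a_k Y_k], beyond the first moments of Y_k that are
    controlled. *)

Lemma dotC u v : dot u v = dot v u.
Proof. by apply: eq_bigr => i _; rewrite mulrC. Qed.

Lemma dotDl u v y : dot (u + v) y = dot u y + dot v y.
Proof. by rewrite -big_split; apply: eq_bigr => i _; rewrite mxE mulrDl. Qed.

Lemma dotZl c u v : dot (c *: u) v = c * dot u v.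
Proof. by rewrite mulr_sumr; apply: eq_bigr => i _; rewrite mxE mulrA. Qed.

Lemma dotNl u v : dot (- u) v = - dot u v.
Proof. by rewrite -scaleN1r dotZl mulN1r. Qed.

Lemma dotDr y u v : dot y (u + v) = dot y u + dot y v.
Proof. by rewrite dotC dotDl !(dotC y). Qed.

Lemma dotZr c u v : dot u (c *: v) = c * dot u v.
Proof. by rewrite dotC dotZl dotC. Qed.

Lemma dotNr u v : dot u (- v) = - dot u v.
Proof. by rewrite dotC dotNl dotC. Qed.

Definition dotE := (dotDl, dotDr, dotNl, dotNr, dotZl, dotZr).

Lemma dot_suml (I : Type) (r : seq I) (F : I -> 'cV[R]_n) v :
  dot (\sum_(i <- r) F i) v = \sum_(i <- r) dot (F i) v.
Proof.
elim/big_ind2: _ => [|_ x _ y <- <-|//]; last by rewrite dotDl.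
by rewrite /dot big1 // => i _; rewrite mxE mul0r.
Qed.

Lemma dot_ge0 u : 0 <= dot u u.
Proof. by apply: sumr_ge0 => i _; rewrite -expr2 sqr_ge0. Qed.

Lemma enorm_ge0 u : 0 <= enorm u.
Proof. exact: sqrtr_ge0. Qed.

Lemma enorm_sqr u : enorm u ^+ 2 = dot u u.
Proof. by rewrite sqr_sqrtr // dot_ge0. Qed.

Lemma enorm_le_sqr u c : 0 <= c -> (enorm u <= c) = (dot u u <= c ^+ 2).
Proof. by move=> c0; rewrite -enorm_sqr ler_sqr // nnegrE enorm_ge0. Qed.

Lemma le_enorm_add1 u : enorm u <= 1 + dot u u.
Proof.
by have := enorm_ge0 u; rewrite -enorm_sqr; have := sqr_ge0 (enorm u - 1); nra.
Qed.

Lemma dot_young u v : 2 * dot u v <= dot u u + dot v v.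
Proof. by have := dot_ge0 (u - v); rewrite !dotE (dotC v u); lra. Qed.

Lemma coord_sqr_le u i : u i 0 ^+ 2 <= dot u u.
Proof.
rewrite /dot (bigD1 i) //= -expr2 lerDl.
by apply: sumr_ge0 => j _; rewrite -expr2 sqr_ge0.
Qed.

Lemma cauchy_schwarz u v : `|dot u v| <= enorm u * enorm v.
Proof.
have uv := dot_ge0 (dot v v *: u - dot u v *: v).
rewrite -(ger0_norm (mulr_ge0 (enorm_ge0 u) (enorm_ge0 v))) -ler_sqr ?nnegrE //.
rewrite !real_normK ?num_real// exprMn !enorm_sqr.
move: uv; rewrite !dotE (dotC v u).
have [v0|v0] := eqVneq (dot v v) 0; last first.
  have : 0 < dot v v by rewrite lt_neqAle eq_sym v0 dot_ge0.
  move: (dot u u) (dot v v) (dot u v) => A B C B0 h.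
  rewrite -(ler_pM2l B0); nra.
have -> : dot u v = 0; last by move=> _; rewrite expr0n v0 mulr0.
rewrite /dot big1 // => i _; apply/eqP; rewrite mulf_eq0 -(sqrf_eq0 (v i 0)).
apply/orP; right; rewrite eq_le sqr_ge0 andbT -v0.
exact: coord_sqr_le.
Qed.

Lemma dot_le_enorm u v : dot u v <= enorm u * enorm v.
Proof. exact: le_trans (ler_norm _) (cauchy_schwarz u v). Qed.

Lemma coord_le_enorm u i : `|u i 0| <= enorm u.
Proof.
by rewrite -ler_sqr ?nnegrE ?enorm_ge0// real_normK ?num_real// enorm_sqr coord_sqr_le.
Qed.

Lemma enorm_le_coord u c : 0 <= c -> (forall i, `|u i 0| <= c) ->
  enorm u <= n%:R * c.
Proof.
move=> c0 uc; rewrite enorm_le_sqr ?mulr_ge0//.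
apply: (@le_trans _ _ (\sum_(i < n) c ^+ 2)).
  by apply: ler_sum => i _; rewrite -expr2 -real_normK ?num_real// ler_sqr ?nnegrE.
rewrite sumr_const card_ord -[leLHS]mulr_natl exprMn ler_wpM2r ?sqr_ge0//.
by rewrite -natrX ler_nat; case: (n) => // k; rewrite -mulnn leq_pmulr.
Qed.

Lemma dot_sum_le (I : finType) (F : I -> 'cV[R]_n) :
  dot (\sum_i F i) (\sum_i F i) <= #|I|%:R * \sum_i dot (F i) (F i).
Proof.
have -> : dot (\sum_i F i) (\sum_i F i) = \sum_i \sum_j dot (F i) (F j).
  rewrite dot_suml; apply: eq_bigr => i _.
  by rewrite dotC dot_suml; apply: eq_bigr => j _; rewrite dotC.
rewrite -(ler_pM2l (ltr0Sn R 1)) mulr_sumr.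
apply: (@le_trans _ _ (\sum_i \sum_j (dot (F i) (F i) + dot (F j) (F j)))).
  by apply: ler_sum => i _; rewrite mulr_sumr; apply: ler_sum => j _; exact: dot_young.
under eq_bigr do rewrite big_split /= sumr_const.
by rewrite big_split /= sumrMnl sumr_const [X in 2 * X]mulr_natl [leRHS]mulr_natl mulr2n.
Qed.

End euclidean_space.

Section proximal_step.
Context {R : realType} {n : nat}.
Implicit Types (u v y d x a b : 'cV[R]_n) (c : R).
Variables (C : set 'cV[R]_n) (convexC : @convex_set R 'cV[R]_n C).

Lemma convex_comb (t : R) y a : 0 <= t -> t <= 1 -> C y -> C a ->
  C (a + t *: (y - a)).
Proof.
move=> t0 t1 Cy Ca.
have := set_mem (@convexC y a (Itv01 t0 t1) (mem_set Cy) (mem_set Ca)).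
congr (C _).
rewrite [LHS](_ : _ = t *: y + (1 - t) *: a)//.
by rewrite scalerBl scale1r scalerBr addrCA.
Qed.

(** First-order optimality: [a] is the projection of [x - c *: d] on [C]. Comparing [a] with the
    point at fraction [t] of the segment towards [y] gives 0 <= 2A + tB after division by t. *)
Lemma prox_variational c d x a y : 0 < c ->
  is_argmin C (fun y => dot d (y - x) + (2 * c)^-1 * enorm (y - x) ^+ 2) a ->
  C y -> 0 <= dot (a - (x - c *: d)) (y - a).
Proof.
move=> c0 [Ca amin] Cy.
set A := dot _ _; set B := dot (y - a) (y - a).
have B0 : 0 <= B by exact: dot_ge0.
have key (t : R) : 0 < t -> t <= 1 -> 0 <= 2 * A + t * B.
  move=> t0 t1; have := amin _ (convex_comb (ltW t0) t1 Cy Ca).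
  rewrite !enorm_sqr -(ler_pM2l (mulr_gt0 (ltr0Sn R 1) c0)) !mulrDr !mulVKf; last 2 first.
    by rewrite mulf_neq0 ?gt_eqF.
    by rewrite mulf_neq0 ?gt_eqF.
  rewrite -subr_ge0 => h.
  rewrite -(pmulr_rge0 _ t0); apply: le_trans h _.
  rewrite /A /B !dotE !(dotC _ a) !(dotC _ x) ?(dotC y d).
  rewrite le_eqVlt; apply/orP; left; apply/eqP; ring.
rewrite leNgt; apply/negP => A0.
have D0 : 0 < B - A by lra.
(* If A were negative, this fraction, which lies in (0, 1], would already make 2A + tB negative,
   because B / (B - A) < 1; no limit t -> 0 is taken. *)
have := key (- A / (B - A)).
rewrite divr_gt0 ?oppr_gt0// ler_pdivrMr// mul1r => /(_ isT) h.
have {h} : 0 <= 2 * A + - A / (B - A) * B by apply: h; lra.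
have -> : - A / (B - A) * B = (- A) * (B / (B - A)) by ring.
have : B / (B - A) < 1 by rewrite ltr_pdivrMr// mul1r; lra.
nra.
Qed.

(** With u = x - c d, expand |u - y|^2 around [a]: the cross term is nonnegative by the variational
    inequality, and |u - a|^2 is dropped. *)
Lemma prox_dist c d x a y : 0 < c ->
  is_argmin C (fun y => dot d (y - x) + (2 * c)^-1 * enorm (y - x) ^+ 2) a ->
  C y -> dot (a - y) (a - y) <= dot (x - c *: d - y) (x - c *: d - y).
Proof.
move=> c0 amin Cy; have := prox_variational c0 amin Cy.
move: (x - c *: d) => u; have := dot_ge0 (u - a).
rewrite !dotE !(dotC _ a) !(dotC y u); lra.
Qed.

Lemma prox_step c d x a : 0 < c -> C x ->
  is_argmin C (fun y => dot d (y - x) + (2 * c)^-1 * enorm (y - x) ^+ 2) a ->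
  enorm (a - x) <= c * enorm d.
Proof.
move=> c0 Cx amin; have := prox_dist c0 amin Cx.
have -> : x - c *: d - x = - (c *: d) by rewrite addrAC subrr add0r.
rewrite enorm_le_sqr ?mulr_ge0 ?enorm_ge0 ?(ltW c0)// exprMn enorm_sqr.
by rewrite dotNl dotNr dotZl dotZr opprK mulrA -expr2.
Qed.

(** Adding the variational inequalities of the two minimisers, each tested at the other, gives |a -
    a'|^2 <= <u - u', a - a'>. This is what makes the iterates measurable: a minimiser is a
    1-Lipschitz function of the point projected. *)
Lemma prox_nonexpansive c d d' x x' a a' : 0 < c ->
  is_argmin C (fun y => dot d (y - x) + (2 * c)^-1 * enorm (y - x) ^+ 2) a ->
  is_argmin C (fun y => dot d' (y - x') + (2 * c)^-1 * enorm (y - x') ^+ 2) a' ->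
  enorm (a - a') <= enorm ((x - c *: d) - (x' - c *: d')).
Proof.
move=> c0 amin amin'.
have := prox_variational c0 amin amin'.1; have := prox_variational c0 amin' amin.1.
move: (x - c *: d) (x' - c *: d') => u u'.
rewrite enorm_le_sqr ?enorm_ge0// enorm_sqr.
have := dot_young (u - u') (a - a').
rewrite !dotE !(dotC _ a) !(dotC _ a') ?(dotC u' u); lra.
Qed.

End proximal_step.

(** Turns the dual ascent step into a proximal step in direction [- d], so that the same estimates
    serve both half-steps. *)
Lemma is_argmax_argmin (R : realType) (n : nat) (C : set 'cV[R]_n) c d x a :
  is_argmax C (fun y => dot d (y - x) - (2 * c)^-1 * enorm (y - x) ^+ 2) a ->
  is_argmin C (fun y => dot (- d) (y - x) + (2 * c)^-1 * enorm (y - x) ^+ 2) a.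
Proof. by move=> [Ca h]; split=> // b /h; rewrite !dotNl; lra. Qed.

Lemma convex_orthant (R : realType) (n : nat) :
  @convex_set R 'cV[R]_n orthant.
Proof.
move=> x y t /set_mem x0 /set_mem y0; apply/mem_set => i.
by rewrite !mxE addr_ge0// mulr_ge0// /onem subr_ge0.
Qed.

(** * Measurability of vector-valued functions *)

Section measurability_cV.
Context d {T : measurableType d} {R : realType}.

Lemma mx_ballE (n : nat) (x y : 'cV[R]_n) (e : R) : 0 < e ->
  ball x e y <-> forall i, `|x i 0 - y i 0| < e.
Proof.
move=> e0; split=> [[_ h] i|h]; first exact: (h i 0).
by split=> // i j; rewrite (ord1 j); exact: h.
Qed.

(** Every open set is the countable union of the boxes with rational centre and half-width 1/(k+1)
    that it contains, and the preimage of a box is a finite intersection of coordinate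
    conditions. *)
Lemma measurable_borel_cV n (u : T -> 'cV[R]_n) :
  (forall i, measurable_fun [set: T] (fun t => u t i 0)) ->
  measurable_fun [set: T] (u : T -> borel_cV R n).
Proof.
move=> mu; apply: (@measurability _ _ T (borel_cV R n) setT u (@open 'cV[R]_n)) => //.
move=> _ [ O oO <-]; rewrite setTI.
pose box (qk : 'cV[rat]_n * nat) : set 'cV[R]_n :=
  [set v | forall i, `|v i 0 - ratr (qk.1 i 0)| < qk.2.+1%:R^-1].
have -> : u @^-1` O = \bigcup_qk
    (u @^-1` [set v | box qk v /\ box qk `<=` O]).
  apply/seteqP; split=> [t Ot|t [qk _ [/= ubox]]]; last exact.
  have := open_nbhs_nbhs (conj oO Ot); rewrite -nbhs_ballE => -[e /= e0 eO].
  (* A box of half-width below e/2 that contains [u t] lies in the sup-norm ball of radius e around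
     [u t]. *)
  have [k ke] : exists k : nat, k.+1%:R^-1 < e / 2.
    exists (Num.truncn (e / 2)^-1); rewrite invf_plt ?posrE ?divr_gt0//.
    by rewrite truncnS_gt.
  have qP i : exists q : rat, `|u t i 0 - ratr q| < k.+1%:R^-1.
    have /rat_in_itvoo[q] : u t i 0 - k.+1%:R^-1 < u t i 0 + k.+1%:R^-1.
      by rewrite ltrBlDr -addrA ltrDl addr_gt0 ?invr_gt0.
    rewrite in_itv/= => /andP[h1 h2]; exists q.
    move: (_^-1) h1 h2 => c h1 h2; rewrite ltr_norml; apply/andP; split; lra.
  have [q qE] := choice qP.
  exists (\col_i q i, k) => //; split; first by move=> i; rewrite mxE.
  move=> v vbox; apply: eO; apply/mx_ballE => // i.
  have := vbox i; have := qE i; rewrite /= mxE; move: (k.+1%:R^-1) ke => c ke.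
  by rewrite !ltr_norml => /andP[? ?] /andP[? ?]; apply/andP; split; lra.
apply: countable_bigcupT_measurable; first exact: countableP.
move=> qk; have [bO|bO] := pselect (box qk `<=` O); last first.
  rewrite (_ : _ @^-1` _ = set0)//.
  by apply/seteqP; split=> // t [_ /bO].
rewrite (_ : _ @^-1` _ = \bigcap_(i in [set: 'I_n])
  (fun t => `|u t i 0 - ratr (qk.1 i 0)|) @^-1` `]-oo, qk.2.+1%:R^-1[); last first.
  apply/seteqP; split=> t /= h.
    by move=> i _; rewrite /= in_itv/=; case: h => /(_ i).
  by split=> // i; have := h i I; rewrite /= in_itv.
apply: fin_bigcap_measurable; first exact: finite_finset.
move=> i _; rewrite -[X in measurable X]setTI.
have mi : measurable_fun [set: T] (fun t => `|u t i 0 - ratr (qk.1 i 0)|).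
  by apply: measurableT_comp => //; exact: measurable_funB.
exact: mi.
Qed.

(** The set where [y] exceeds r is the preimage under [u] of an open set, a union of balls whose
    radii are so small that the Lipschitz bound keeps [y] above r. Thus [y] need not be presented as
    a function of [u] defined on the whole space. *)
Lemma lipschitz_measurable n (u : T -> 'cV[R]_n) (y : T -> R) (L : R) :
  (forall i, measurable_fun [set: T] (fun t => u t i 0)) ->
  (forall s t, `|y s - y t| <= L * enorm (u s - u t)) ->
  measurable_fun [set: T] y.
Proof.
(* The factor n passes from the sup norm of the balls to the Euclidean norm; the added 1 makes c
   positive and the final comparison strict. The sign of [L] is not assumed. *)
move=> mu yL; pose c := `|L| * n%:R + 1.
have c0 : 0 < c by rewrite ltr_wpDl// mulr_ge0.
apply: (measurability _ (RGenOInfty.measurableE R)) => // _ [_ [r ->] <-].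
pose O : set 'cV[R]_n :=
  \bigcup_(t in [set t | r < y t]) ball (u t) ((y t - r) / c).
have oO : open O by apply: bigcup_open => t rt; exact: ball_open.
suff -> : [set: T] `&` y @^-1` `]r, +oo[ = [set: T] `&` u @^-1` O.
  apply: measurable_borel_cV => //; exact: sub_sigma_algebra.
rewrite !setTI; apply/seteqP; split=> t /=; rewrite in_itv/= andbT => rt.
  by exists t => //; apply: ballxx; rewrite divr_gt0 ?subr_gt0.
case: rt => s /= rs ball_st.
have r0 : 0 < (y s - r) / c by rewrite divr_gt0 ?subr_gt0.
have /(mx_ballE _ _ r0) ust := ball_st.
have : enorm (u s - u t) <= n%:R * ((y s - r) / c).
  by apply: enorm_le_coord => [|i]; rewrite ?ltW// !mxE.
have := le_trans (yL s t) (ler_wpM2r (enorm_ge0 _) (ler_norm L)).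
move=> /le_trans h /(ler_wpM2l (normr_ge0 L))/h {}h.
have : `|L| * (n%:R * ((y s - r) / c)) < y s - r.
  rewrite !mulrA ltr_pdivrMr// [ltRHS]mulrC ltr_pM2r ?subr_gt0//.
  by rewrite /c ltrDl.
by move: h; rewrite ler_norml; lra.
Qed.

End measurability_cV.

Definition measurable_coords {d : measure_display} {S : measurableType d}
    {R : realType} {n : nat} (u : S -> 'cV[R]_n) :=
  forall j, measurable_fun [set: S] (fun s => u s j 0).

Section measurable_coords.
Context {d : measure_display} {S : measurableType d} {R : realType} {n : nat}.
Implicit Types u v : S -> 'cV[R]_n.

Lemma measurable_coords_cst (a : 'cV[R]_n) : measurable_coords (fun _ : S => a).
Proof. by move=> j; exact: measurable_cst. Qed.

Lemma measurable_coordsD u v : measurable_coords u -> measurable_coords v ->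
  measurable_coords (fun s => u s + v s).
Proof.
by move=> mu mv j; under eq_fun do rewrite mxE; exact: measurable_funD.
Qed.

Lemma measurable_coordsZ (c : S -> R) u : measurable_fun [set: S] c ->
  measurable_coords u -> measurable_coords (fun s => c s *: u s).
Proof.
by move=> mc mu j; under eq_fun do rewrite mxE; exact: measurable_funM.
Qed.

Lemma measurable_coordsN u : measurable_coords u -> measurable_coords (fun s => - u s).
Proof.
move=> mu j; under eq_fun do rewrite mxE; exact: measurable_funN.
Qed.

Lemma measurable_coordsB u v : measurable_coords u -> measurable_coords v ->
  measurable_coords (fun s => u s - v s).
Proof. by move=> mu /measurable_coordsN; exact: measurable_coordsD. Qed.

Lemma measurable_coords_sum (I : Type) (r : seq I) (u : I -> S -> 'cV[R]_n) :
  (forall i, measurable_coords (u i)) ->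
  measurable_coords (fun s => \sum_(i <- r) u i s).
Proof.
move=> mu j; under eq_fun do rewrite summxE.
by apply: measurable_sum => i; exact: mu.
Qed.

Lemma measurable_dot u v : measurable_coords u -> measurable_coords v ->
  measurable_fun [set: S] (fun s => dot (u s) (v s)).
Proof. by move=> mu mv; apply: measurable_sum => j; exact: measurable_funM. Qed.

End measurable_coords.

(** * Independence of a sample from the past *)

Section independent_integral.
Context {d d1 d2 : measure_display} {T : measurableType d}.
Context {S : measurableType d1} {Om : measurableType d2}.
Context {R : realType} (Q : probability T R) (P : probability Om R).

(** By independence on rectangles and uniqueness of the product measure, the joint law of [X] and
    [W] is the product of the law of [X] and [P]; Tonelli then integrates over the second variable
    first. *)
Lemma independent_integral (X : T -> S) (W : {mfun T >-> Om})
  (phi : S * Om -> \bar R) :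
  measurable_fun [set: T] X ->
  (forall A B, measurable A -> measurable B ->
    Q (X @^-1` A `&` W @^-1` B) = (Q (X @^-1` A) * P B)%E) ->
  measurable_fun [set: S * Om] phi -> (forall y, 0 <= phi y)%E ->
  (\int[Q]_t phi (X t, W t) = \int[Q]_t \int[P]_w phi (X t, w))%E.
Proof.
move=> mX indep mphi phi0.
pose X' : {mfun T >-> S} := mfun_Sub (mem_set mX).
have mh : measurable_fun [set: T] (fun t => (X t, W t)).
  exact: measurable_fun_pair.
pose h : {mfun T >-> (S * Om)%type} := mfun_Sub (mem_set mh).
have -> : (\int[Q]_t phi (X t, W t) = \int[distribution Q h]_y phi y)%E.
  by rewrite ge0_integral_distribution.
have -> : (\int[Q]_t \int[P]_w phi (X t, w) =
    \int[distribution Q X']_x fubini_F P phi x)%E.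
  rewrite ge0_integral_distribution//.
    exact: measurable_fun_fubini_tonelli_F.
  by move=> x; apply: integral_ge0.
rewrite -fubini_tonelli1//.
apply: eq_measure_integral => A mA _.
apply/esym; apply: product_measure_unique => // B C mB mC; exact: indep.
Qed.

End independent_integral.

Section past.
Context {d d' : measure_display} {T : measurableType d} {Om : measurableType d'}.
Context {R : realType} (Q : probability T R) (P : probability Om R).
Variable X : nat -> {mfun T >-> Om}.

(** A family closed under intersection that generates the sigma-algebra of the samples of index
    below j. [pastType j] is [T] with that sigma-algebra, so depending on the past only means being
    measurable on [pastType j]. *)
Definition past_cylinders (j : nat) : set (set T) :=
  [set E | exists2 A : nat -> set Om, (forall i, measurable (A i)) &
           E = \bigcap_(i in `I_j) X i @^-1` A i].

Definition pastType j := g_sigma_algebraType (past_cylinders j).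

Lemma sub_past_cylinders j : past_cylinders j `<=` measurable.
Proof.
move=> _ [A mA ->]; apply: bigcap_measurableType => // i _.
by rewrite -[X in measurable X]setTI; exact: measurable_funPT.
Qed.

Lemma measurable_past j (E : set T) : @measurable _ (pastType j) E -> measurable E.
Proof.
by apply: smallest_sub; [exact: sigma_algebra_measurable|exact: sub_past_cylinders].
Qed.

Lemma past_le j k : (j <= k)%N -> past_cylinders j `<=` past_cylinders k.
Proof.
move=> jk _ [A mA ->]; exists (fun i => if (i < j)%N then A i else [set: Om]).
  by move=> i; case: ifP.
apply/seteqP; split=> t /= h i /= ik.
  by case: ifPn => // ij; exact: h.
by have := h i (leq_trans ik jk); rewrite /= ik.
Qed.

Lemma measurable_past_sample j k : (j < k)%N ->
  measurable_fun [set: pastType k] (X j : pastType k -> Om).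
Proof.
move=> jk _ B mB; rewrite setTI; apply: sub_sigma_algebra.
exists (fun i => if i == j then B else [set: Om]).
  by move=> i; case: ifP.
apply/seteqP; split=> t /= h.
  by move=> i /= _; case: ifPn => // /eqP ->.
by have := h j jk; rewrite /= eqxx.
Qed.

Lemma measurable_fun_past (d1 : measure_display) (S : measurableType d1) j k
    (f : T -> S) : (j <= k)%N ->
  measurable_fun [set: pastType j] (f : pastType j -> S) ->
  measurable_fun [set: pastType k] (f : pastType k -> S).
Proof.
move=> jk mf _ B mB; have := mf measurableT B mB.
rewrite !setTI; apply: sub_sigma_algebra2; exact: past_le.
Qed.

Lemma measurable_fun_of_past (d1 : measure_display) (S : measurableType d1) j
    (f : T -> S) :
  measurable_fun [set: pastType j] (f : pastType j -> S) ->
  measurable_fun [set: T] f.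
Proof.
move=> mf _ B mB; have := mf measurableT B mB.
rewrite !setTI; exact: measurable_past.
Qed.

Hypothesis indep : forall j (A : nat -> set Om), (forall i, measurable (A i)) ->
  Q (\bigcap_(i in `I_j.+1) X i @^-1` A i) =
  (Q (\bigcap_(i in `I_j) X i @^-1` A i) * P (A j))%E.

(** Both sides are finite measures in [E]. They agree on the past cylinders, where the hypothesis
    applies with [B] placed in slot j, hence on the sigma-algebra these generate. *)
Lemma past_independent j (E : set T) (B : set Om) :
  @measurable _ (pastType j) E -> measurable B ->
  Q (E `&` X j @^-1` B) = (Q E * P B)%E.
Proof.
move=> mE mB.
have mXB : measurable (X j @^-1` B).
  by rewrite -[X in measurable X]setTI; exact: measurable_funPT.
have PB : 0 <= fine (P B) by exact: fine_ge0.
pose m1 : measure T R := mrestr Q mXB.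
pose m2 : measure T R := mscale (NngNum PB) Q.
have m1E A : m1 A = Q (A `&` X j @^-1` B) by [].
have m2E A : m2 A = (Q A * P B)%E.
  by rewrite muleC -[P B]fineK ?fin_num_measure.
suff : m1 E = m2 E by rewrite m1E m2E.
apply: (@g_sigma_algebra_measure_unique _ _ _ (past_cylinders j)
  (@sub_past_cylinders j) (fun=> [set: T]) _ _ m1 m2) => //.
- move=> _; exists (fun=> [set: Om]) => //.
  by apply/seteqP; split.
- by apply/seteqP; split=> // t _; exists 0%N.
- move=> _ _ [A mA ->] [A' mA' ->].
  exists (fun i => A i `&` A' i); first by move=> i; exact: measurableI.
  by rewrite -bigcapI.
- move=> _ [A mA ->].
  rewrite m1E m2E.
  have H := @indep j (fun i => if i == j then B else A i).
  have {}H := H _; rewrite eqxx in H.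
  have -> : \bigcap_(i in `I_j) X i @^-1` A i = \bigcap_(i in `I_j)
      X i @^-1` (if i == j then B else A i).
    apply: eq_bigcapr => i /= ij; by rewrite ltn_eqF.
  rewrite -H; last by move=> i; case: ifP.
  congr (Q _).
  apply/seteqP; split=> t /=.
    move=> [h hB] i /=; rewrite ltnS leq_eqVlt => /orP[/eqP ->|ij].
      by rewrite eqxx.
    exact: h.
  move=> h; split; first by move=> i /= ij; apply: h; exact: ltnW.
  by have := h j (ltnSn j); rewrite /= eqxx.
- move=> _; rewrite m1E; apply: le_lt_trans (probability_le1 _ _) _; rewrite ?ltry//.
  exact: measurableI.
Qed.

(** The random element describing the past is the identity from [T] to [pastType j]: [phi] may then
    depend on the outcome [t] itself, provided it does so through the past. *)
Lemma integral_past_sample j (phi : T -> Om -> R) :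
  measurable_fun [set: pastType j * Om]
    ((fun p => phi p.1 p.2) : pastType j * Om -> R) ->
  (forall t o, 0 <= phi t o) ->
  (\int[Q]_t (phi t (X j t))%:E = \int[Q]_t \int[P]_o (phi t o)%:E)%E.
Proof.
move=> mphi phi0.
apply: (@independent_integral _ _ _ T (pastType j) Om _ Q P id (X j)
  (fun p => (phi p.1 p.2)%:E)) => //.
- move=> _ B mB; rewrite setTI. apply: measurable_past mB.
- by move=> A B mA mB; exact: past_independent.
- exact/measurable_EFinP.
- by move=> y; rewrite lee_fin.
Qed.

Lemma le_integral_past_sample j (phi : T -> Om -> R) (U : T -> R) :
  measurable_fun [set: pastType j * Om]
    ((fun p => phi p.1 p.2) : pastType j * Om -> R) ->
  (forall t o, 0 <= phi t o) -> measurable_fun [set: T] U ->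
  (forall t, \int[P]_o (phi t o)%:E <= (U t)%:E)%E ->
  (\int[Q]_t (phi t (X j t))%:E <= \int[Q]_t (U t)%:E)%E.
Proof.
move=> mphi phi0 mU phiU; rewrite (integral_past_sample mphi phi0).
apply: ge0_le_integral => //.
- by move=> t _; apply: integral_ge0 => o _; rewrite lee_fin.
- apply: (@measurable_fun_of_past _ _ j).
  apply: (@measurable_fun_fubini_tonelli_F _ _ (pastType j) Om R P
    (fun p => (phi p.1 p.2)%:E)); first exact/measurable_EFinP.
  by move=> p; rewrite lee_fin.
- exact/measurable_EFinP.
Qed.

End past.

(** * Merging the two families of samples into one sequence *)

Section interleaved_samples.
Context {d d' : measure_display} {T : measurableType d} {Om : measurableType d'}.
Context {R : realType} (Q : probability T R) (P : probability Om R).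
Variables w w' : nat -> {RV Q >-> Om}.

(* The samples in the order in which the method draws them. *)
Definition sample (j : nat) : {RV Q >-> Om} :=
  if odd j then w' j./2 else w j./2.

Hypothesis iid : iid_samples P w w'.

(** [emb] sends a position in the merged sequence to its label in the two families, and [J n]
    collects the first n labels. As [emb] is injective, passing from [J j] to [J j.+1] adds exactly
    one factor to the product given by mutual independence. *)
Lemma sample_independent j (A : nat -> set Om) : (forall i, measurable (A i)) ->
  Q (\bigcap_(i in `I_j.+1) sample i @^-1` A i) =
  (Q (\bigcap_(i in `I_j) sample i @^-1` A i) * P (A j))%E.
Proof.
move=> mA; case: iid => indep lawP law'P.
pose X (i : nat + nat) := match i with inl k => w k | inr k => w' k end.
pose emb j : nat + nat := if odd j then inr j./2 else inl j./2.
pose inv (i : nat + nat) := match i with inl k => k.*2 | inr k => k.*2.+1 end.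
have embK : cancel emb inv.
  by move=> k; rewrite /emb -[RHS]odd_double_half; case: ifP.
have XembE k : X (emb k) = sample k by rewrite /emb /sample; case: ifP.
have QA k : Q (sample k @^-1` A k) = P (A k).
  by rewrite /sample; case: ifP => _; [exact: law'P|exact: lawP].
pose J := fix J n := if n is k.+1 then (emb k |` J k)%fset else fset0.
have JE n i : (i \in J n) <-> exists2 k, (k < n)%N & i = emb k.
  elim: n => [|n IH] /=; first by rewrite inE; split=> // -[].
  rewrite in_fset1U; split=> [/orP[/eqP ->|Ji]|[k]].
  - by exists n.
  - by have [k kn ->] := IH.1 Ji; exists k => //; exact: ltnW.
  - rewrite ltnS leq_eqVlt => /orP[/eqP -> ->|kn ik]; first by rewrite eqxx.
    by apply/orP; right; apply: IH.2; exists k.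
have QJ n : Q (\bigcap_(i in `I_n) sample i @^-1` A i) =
    (\prod_(i <- J n) Q (X i @^-1` A (inv i)))%E.
  rewrite -(indep (J n) (fun i => A (inv i))) => [|i _]; last exact: mA.
  congr (Q _); apply/seteqP; split=> t h.
    by move=> i /JE[k kn ->]; rewrite /= embK -/(X _) XembE; exact: h.
  move=> k kn; have := h (emb k); rewrite /= embK -/(X _) XembE; apply.
  by apply/JE; exists k.
rewrite !QJ [J j.+1]/= big_fsetU1/=; last first.
  apply/negP => /JE[k kj /(can_inj embK) jk].
  by rewrite jk ltnn in kj.
by rewrite embK XembE QA muleC.
Qed.

End interleaved_samples.

(** * Almost sure boundedness and summability *)

Section almost_sure.
Context {d : measure_display} {T : measurableType d} {R : realType}.
Variable Q : probability T R.

(** By monotone convergence the whole series has integral at most [B], so it is finite almost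
    everywhere and bounds its own partial sums. *)
Lemma ae_bounded_partial_sums (u : nat -> T -> R) (B : R) :
  (forall k, measurable_fun [set: T] (u k)) -> (forall k t, 0 <= u k t) ->
  (forall n, \sum_(k < n) \int[Q]_t (u k t)%:E <= B%:E)%E ->
  {ae Q, forall t, exists M : R, forall n, \sum_(k < n) u k t <= M}.
Proof.
move=> mu u0 uB.
have mU : measurable_fun [set: T] (fun t => \sum_(0 <= k <oo) (u k t)%:E)%E.
  by apply: ge0_emeasurable_sum => k *; [rewrite lee_fin|exact/measurable_EFinP].
have U0 t : (0 <= \sum_(0 <= k <oo) (u k t)%:E)%E.
  by apply: nneseries_ge0 => k _ _; rewrite lee_fin.
have intU : Q.-integrable [set: T] (fun t => \sum_(0 <= k <oo) (u k t)%:E)%E.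
  apply/integrableP; split=> //.
  under eq_integral do rewrite gee0_abs//.
  rewrite integral_nneseries//; last 2 first.
    by move=> k; exact/measurable_EFinP.
    by move=> k t _; rewrite lee_fin.
  apply: (@le_lt_trans _ _ B%:E); last exact: ltry.
  apply: lime_le.
    by apply: is_cvg_nneseries => k _ _; apply: integral_ge0 => t _; rewrite lee_fin.
  by apply: nearW => n; rewrite big_mkord.
have := integrable_ae measurableT intU.
apply: filterS => t /(_ I) finU.
exists (fine (\sum_(0 <= k <oo) (u k t)%:E)%E) => n.
rewrite -lee_fin fineK// -sumEFin -(big_mkord xpredT (fun k => (u k t)%:E)).
by apply: nneseries_lim_ge => k _; rewrite lee_fin.
Qed.

Section maximal_inequality.
Variables (F : nat -> set (set T)) (W : nat -> T -> R) (B : R).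
Hypothesis mF : forall k (E : set T),
  @measurable _ (g_sigma_algebraType (F k)) E -> measurable E.
Hypothesis mW : forall j k, (j <= k)%N ->
  measurable_fun [set: g_sigma_algebraType (F k)] (W j).
Hypothesis W0 : forall k t, 0 <= W k t.
(** The weak form of E[W_{k+1} | F_k] <= W_k. The filtration is given by the generating families
    [F k]; asking in [mW] for all j <= k contains adaptedness and the persistence of past
    information. *)
Hypothesis supermartingale : forall k (phi : T -> R),
  measurable_fun [set: g_sigma_algebraType (F k)] phi -> (forall t, 0 <= phi t) ->
  (\int[Q]_t (phi t * W k.+1 t)%:E <= \int[Q]_t (phi t * W k t)%:E)%E.
Hypothesis intW0 : (\int[Q]_t (W 0%N t)%:E <= B%:E)%E.

Let mFW k : measurable_fun [set: T] (W k).
Proof.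
move=> _ E mE; rewrite setTI; apply: (@mF k).
by have := mW (leqnn k) measurableT mE; rewrite setTI.
Qed.

Let A (l : R) k : set T := [set t | forall j, (j <= k)%N -> W j t < l].

Let mA l k : @measurable _ (g_sigma_algebraType (F k)) (A l k).
Proof.
have -> : A l k = \bigcap_(j in `I_k.+1) (W j @^-1` `]-oo, l[).
  by apply/seteqP; split=> t /= h j; have := h j; rewrite /= in_itv/= ltnS.
apply: bigcap_measurableType => // j /=; rewrite ltnS => jk.
by have := mW jk measurableT (measurable_itv `]-oo, l[); rewrite setTI.
Qed.

Lemma maximal_inequality l k : 0 < l -> (l%:E * Q (~` A l k) <= B%:E)%E.
Proof.
move=> l0.
pose phi k t : R := \1_(A l k) t.
have phi01 k' t : 0 <= phi k' t <= 1.
  by rewrite /phi indicE; case: (t \in _); rewrite /= ?ler01 ?lexx.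
have mphi k' : measurable_fun [set: g_sigma_algebraType (F k')] (phi k').
  exact: measurable_indic.
have mphi' k' : measurable_fun [set: T] (phi k').
  by apply: measurable_indic; exact: (@mF k').
have mstop i j : measurable_fun [set: T] (fun t => (phi i t * W j t)%:E).
  by apply/measurable_EFinP; exact: measurable_funM.
have mout i : measurable_fun [set: T] (fun t => (l * (1 - phi i t))%:E).
  by apply/measurable_EFinP; apply: measurable_funM => //; exact: measurable_funB.
have msum i j : measurable_fun [set: T]
    (fun t => (phi i t * W j t + l * (1 - phi i t))%:E).
  apply/measurable_EFinP; apply: measurable_funD; apply: measurable_funM => //.
  exact: measurable_funB.
have out0 i t : [set: T] t -> (0 <= (l * (1 - phi i t))%:E)%E.
  by move=> _; rewrite lee_fin mulr_ge0 ?(ltW l0)// subr_ge0; have /andP[] := phi01 i t.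
have stop0 i j t : [set: T] t -> (0 <= (phi i t * W j t)%:E)%E.
  by move=> _; rewrite lee_fin mulr_ge0//; have /andP[] := phi01 i t.
(* Expectation of the process equal to [W k] while all values so far are below l, and to l
   afterwards. *)
pose Z k := (\int[Q]_t (phi k t * W k t + l * (1 - phi k t))%:E)%E.
have ZB : (Z k <= B%:E)%E.
  elim: k => [|k IH].
    apply: le_trans intW0; apply: ge0_le_integral => //.
    - by move=> t _; rewrite EFinD adde_ge0 ?stop0 ?out0.
    - exact/measurable_EFinP.
    move=> t _; rewrite lee_fin /phi indicE.
    have [_|/negP At] := boolP (t \in A l 0%N); first by rewrite /= mul1r subrr mulr0 addr0.
    rewrite /= mul0r add0r subr0 mulr1 leNgt; apply/negP => Wl; apply: At.
    by apply/mem_set => j; rewrite leqn0 => /eqP ->.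
  apply: le_trans IH; rewrite /Z.
  (* A path that first reaches l at time k+1 has l <= [W k.+1], so its value may be raised back to
     [W k.+1]. The indicator that remains is that of time k, an admissible weight. *)
  apply: (@le_trans _ _ (\int[Q]_t (phi k t * W k.+1 t + l * (1 - phi k t))%:E)%E).
    apply: ge0_le_integral => //.
    - by move=> t _; rewrite EFinD adde_ge0 ?stop0 ?out0.
    move=> t _; rewrite lee_fin /phi !indicE.
    have [At|nAt] := boolP (t \in A l k).
      have [_|/negP nAt] := boolP (t \in A l k.+1); first by rewrite lexx.
      rewrite /= !(mul0r, mul1r, subr0, subrr, mulr0, mulr1, addr0, add0r).
      rewrite leNgt; apply/negP => Wl; apply: nAt.
      apply/mem_set => j; rewrite leq_eqVlt => /orP[/eqP -> //|].
      by rewrite ltnS; exact: (set_mem At).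
    have -> : (t \in A l k.+1) = false.
      apply/negP => /set_mem At; move/negP: nAt; apply; apply/mem_set => j jk.
      by apply: At; exact: leqW.
    by rewrite /= !mul0r.
  under eq_integral do rewrite EFinD.
  under [leRHS]eq_integral do rewrite EFinD.
  rewrite (ge0_integralD _ _ (stop0 _ _) (mstop _ _) (out0 _) (mout _))//.
  rewrite (ge0_integralD _ _ (stop0 _ _) (mstop _ _) (out0 _) (mout _))//.
  by apply: leeD => //; apply: supermartingale => // t; have /andP[] := phi01 k t.
apply: le_trans ZB.
have mAC : measurable (~` A l k) by apply: measurableC; exact: (@mF k).
rewrite -integral_cst//.
apply: (@le_trans _ _ (\int[Q]_(t in ~` A l k)
    (phi k t * W k t + l * (1 - phi k t))%:E)%E).
  apply: ge0_le_integral => //.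
  - by move=> t _; rewrite lee_fin ltW.
  - exact: measurable_funS (msum k k).
  move=> t /= nAt; rewrite lee_fin /phi indicE memNset//.
  by rewrite /= mul0r add0r subr0 mulr1.
apply: ge0_subset_integral => // t _.
by rewrite EFinD adde_ge0 ?stop0 ?out0.
Qed.

(** [U n] is the event that some value reaches n+1. Continuity from below carries the maximal
    inequality from finite horizons to [U n], whose probability is thus at most B/(n+1); unbounded
    paths lie in every [U n]. *)
Lemma ae_bounded_supermartingale : {ae Q, forall t, exists M, forall k, W k t <= M}.
Proof.
pose U n := \bigcup_k ~` A n.+1%:R k.
have mU n : measurable (U n).
  by apply: bigcup_measurable => k _; apply: measurableC; exact: (@mF k).
have QU n : (n.+1%:R%:E * Q (U n) <= B%:E)%E.
  have cvgQ : (Q \o (fun k => ~` A n.+1%:R k)) @ \oo --> Q (U n).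
    apply: nondecreasing_cvg_mu; [|exact: mU|].
      by move=> k; apply: measurableC; exact: (@mF k).
    move=> i j ij; apply/subsetPset => t; apply: contra_not => h m mi.
    by apply: h; exact: leq_trans ij.
  have := cvgeZl (isT : n.+1%:R%:E \is a fin_num) cvgQ.
  move=> /[dup] /cvg_lim <-// /cvgP c; apply: lime_le => //.
  by apply: nearW => k; exact: maximal_inequality.
exists (\bigcap_n U n); split.
- exact: bigcap_measurableType.
- apply/eqP; rewrite eq_le measure_ge0 andbT.
  apply/lee_addgt0Pr => e e0; rewrite add0e.
  have [n nB] : exists n, `|B| / n.+1%:R <= e.
    exists (Num.truncn (`|B| / e)); rewrite ler_pdivrMr// mulrC -ler_pdivrMr//.
    by rewrite ltW// truncnS_gt.
  apply: (@le_trans _ _ (Q (U n))).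
    apply: le_measure; rewrite ?inE//; first exact: bigcap_measurableType.
    by move=> t /(_ n I).
  have := QU n; rewrite -[Q (U n)]fineK ?fin_num_measure// -EFinM !lee_fin.
  rewrite mulrC -ler_pdivlMr// => /le_trans; apply; apply: le_trans nB.
  by rewrite ler_wpM2r// ler_norm.
- move=> t /= h n _; apply: contrapT => nU; apply: h; exists n.+1%:R => k.
  have : A n.+1%:R k t by apply: contrapT => nA; apply: nU; exists k.
  by move=> /(_ k (leqnn k))/ltW.
Qed.

End maximal_inequality.
End almost_sure.

(** * Supermartingales up to summable multiplicative errors *)

Section robbins_siegmund.
Context {d : measure_display} {T : measurableType d} {R : realType}.
Variable Q : probability T R.
Variables (F : nat -> set (set T)) (Y b : nat -> T -> R) (e : nat -> R) (y0 S : R).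
Hypothesis mF : forall k (E : set T),
  @measurable _ (g_sigma_algebraType (F k)) E -> measurable E.
Hypothesis mY : forall j k, (j <= k)%N ->
  measurable_fun [set: g_sigma_algebraType (F k)] (Y j).
Hypothesis mb : forall k, measurable_fun [set: T] (b k).
Hypothesis Y_ge0 : forall k t, 0 <= Y k t.
Hypothesis b_ge0 : forall k t, 0 <= b k t.
Hypothesis e_ge0 : forall k, 0 <= e k.
Hypothesis e_sum : forall n, \sum_(k < n) e k <= S.
Hypothesis Y0 : forall t, Y 0%N t <= y0.
Hypothesis descent : forall k (phi : T -> R),
  measurable_fun [set: g_sigma_algebraType (F k)] phi -> (forall t, 0 <= phi t) ->
  (\int[Q]_t (phi t * Y k.+1 t)%:E + \int[Q]_t (phi t * b k t)%:E <=
   \int[Q]_t (phi t * ((1 + e k) * Y k t))%:E)%E.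

Let mFY k : measurable_fun [set: T] (Y k).
Proof.
move=> _ E mE; rewrite setTI; apply: (@mF k).
by have := mY (leqnn k) measurableT mE; rewrite setTI.
Qed.

Let p k := \prod_(j < k) (1 + e j).

Let p_gt0 k : 0 < p k.
Proof. by apply: prodr_gt0 => j _; rewrite ltr_wpDr. Qed.

Let p_le k : p k <= expR S.
Proof.
apply: (@le_trans _ _ (expR (\sum_(j < k) e j))); last by rewrite ler_expR.
rewrite expR_sum; apply: ler_prod => j _.
by rewrite addr_ge0//= expR_ge1Dx.
Qed.

Let normalized_descent k (phi : T -> R) :
  measurable_fun [set: g_sigma_algebraType (F k)] phi -> (forall t, 0 <= phi t) ->
  (\int[Q]_t (phi t * (Y k.+1 t / p k.+1))%:E +
   \int[Q]_t (phi t * (b k t / p k.+1))%:E <=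
   \int[Q]_t (phi t * (Y k t / p k))%:E)%E.
Proof.
move=> mphi phi0.
(* The weight is divided by the next product, so that the factor 1 + e_k on the right cancels and
   leaves [p k]. *)
have := @descent k (fun t => phi t / p k.+1).
under eq_integral do rewrite -mulrA (mulrC _^-1).
under [X in (_ + X)%E]eq_integral do rewrite -mulrA (mulrC _^-1).
under [leRHS]eq_integral => t _.
  rewrite (_ : _ / _ * _ = phi t * (Y k t / p k)); first over.
  have ek0 : 1 + e k != 0 by rewrite gt_eqF// ltr_wpDr.
  have pk0 : p k != 0 by rewrite gt_eqF.
  rewrite /p big_ord_recr/= -/(p k); field; exact/andP.
apply; first exact: measurable_funM.
by move=> t; rewrite divr_ge0// ltW.
Qed.

(** All products lie between 1 and exp S, so bounds on the normalised quantities return to the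
    original ones at the cost of a factor exp S. *)
Lemma robbins_siegmund :
  {ae Q, forall t, exists M, forall k, Y k t <= M} /\
  exists B : R, forall n, (\sum_(k < n) \int[Q]_t (b k t)%:E <= B%:E)%E.
Proof.
have W0 k t : 0 <= Y k t / p k by rewrite divr_ge0// ltW.
have mW j k : (j <= k)%N ->
    measurable_fun [set: g_sigma_algebraType (F k)] (fun t => Y j t / p j).
  by move=> jk; apply: measurable_funM => //; exact: mY.
have intW0 : (\int[Q]_t (Y 0%N t / p 0%N)%:E <= y0%:E)%E.
  have y0E : (y0%:E = \int[Q]_(t in [set: T]) cst y0%:E t)%E.
    rewrite integral_cst// [X in (_ * X)%E](_ : _ = 1%E) ?mule1//.
    exact: probability_setT.
  rewrite y0E; apply: ge0_le_integral => //.
  - by move=> t _; rewrite lee_fin.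
  - by apply/measurable_EFinP; apply: measurable_funM => //; exact: mFY.
  - by move=> t _; rewrite lee_fin /p big_ord0 divr1.
split.
  have super k (phi : T -> R) :
      measurable_fun [set: g_sigma_algebraType (F k)] phi ->
      (forall t, 0 <= phi t) ->
      (\int[Q]_t (phi t * (Y k.+1 t / p k.+1))%:E <=
       \int[Q]_t (phi t * (Y k t / p k))%:E)%E.
    move=> mphi phi0; apply: le_trans (normalized_descent mphi phi0).
    rewrite leeDl//; apply: integral_ge0 => t _.
    by rewrite lee_fin mulr_ge0// divr_ge0// ltW.
  have := @ae_bounded_supermartingale _ _ _ Q F (fun k t => Y k t / p k) y0
    mF mW W0 super intW0.
  apply: filterS => t [M MW]; exists (M * expR S) => k.
  have := MW k; rewrite ler_pdivrMr// => /le_trans; apply.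
  rewrite ler_wpM2l//.
  exact: le_trans (MW 0%N).
exists (expR S * y0) => n.
(* The terminal term stays on the left throughout the induction, so the telescoping never subtracts
   an integral; it is dropped at the end, being nonnegative. *)
have : (\int[Q]_t (Y n t / p n)%:E +
    \sum_(k < n) \int[Q]_t (b k t / p k.+1)%:E <= y0%:E)%E.
  elim: n => [|n IH]; first by rewrite big_ord0 adde0.
  apply: le_trans IH; rewrite big_ord_recr/= addeCA addeC leeD2r//.
  have := @normalized_descent n (cst 1) (@measurable_cst _ _ _ _ _ _) (fun=> ler01).
  under eq_integral do rewrite mul1r.
  under [X in (_ + X)%E]eq_integral do rewrite mul1r.
  by under [leRHS]eq_integral do rewrite mul1r.
move=> h; rewrite EFinM.
apply: (@le_trans _ _ ((expR S)%:E *
    \sum_(k < n) \int[Q]_t (b k t / p k.+1)%:E)%E).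
  rewrite ge0_sume_distrr; last first.
    by move=> k _; apply: integral_ge0 => t _; rewrite lee_fin divr_ge0// ltW.
  apply: lee_sum => k _.
  rewrite -ge0_integralZl//; last 2 first.
  - by apply/measurable_EFinP; exact: measurable_funM.
  - by move=> t _; rewrite lee_fin divr_ge0// ltW.
  apply: ge0_le_integral => //.
  - by move=> t _; rewrite lee_fin.
  - exact/measurable_EFinP.
  - under eq_fun do rewrite -EFinM.
    apply/measurable_EFinP; apply: measurable_funM => //; exact: measurable_funM.
  move=> t _; rewrite -EFinM lee_fin mulrCA ler_peMr//.
  by rewrite ler_pdivlMr// mul1r.
rewrite lee_wpmul2l ?lee_fin ?expR_ge0//; apply: le_trans h.
by rewrite leeDr//; apply: integral_ge0 => t _; rewrite lee_fin.
Qed.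

End robbins_siegmund.

(** * A deterministic convergence criterion *)

Section deterministic_limit.
Context {R : realType}.

(* The squares a_k^2 form a sequence of bounded variation, so they converge;
   a positive limit would contradict the divergence of the sum of the g_k. *)
Lemma cvg0_of_summable_increments (a g r : nat -> R) (B C : R) :
  (forall k, 0 <= a k) -> (forall k, 0 < g k) ->
  (forall M, exists n, M < \sum_(k < n) g k) ->
  (forall n, \sum_(k < n) g k * a k <= B) ->
  (forall k, `|a k.+1 ^+ 2 - a k ^+ 2| <= r k) ->
  (forall n, \sum_(k < n) r k <= C) ->
  a @ \oo --> 0.
Proof.
move=> a0 g0 gsum gaB ar rC.
have r0 k : 0 <= r k by exact: le_trans (ar k).
pose s n := \sum_(k < n) r k.
have cs : cvgn s.
  apply: nondecreasing_is_cvgn.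
    by apply/nondecreasing_seqP => n; rewrite /s big_ord_recr/= lerDl.
  by exists C => _ [n _ <-]; exact: rC.
(* Adding the partial sums of the increment bounds makes the sequence nondecreasing, which reduces
   bounded variation to monotone convergence. *)
have cas : cvgn (fun n => a n ^+ 2 + s n).
  apply: nondecreasing_is_cvgn.
    apply/nondecreasing_seqP => n; rewrite /s big_ord_recr/=.
    by have := ar n; rewrite ler_norml; lra.
  exists (a 0%N ^+ 2 + C + C) => _ [n _ <-].
  rewrite lerD//; last exact: rC.
  suff : a n ^+ 2 <= a 0%N ^+ 2 + s n.
    by move=> /le_trans; apply; rewrite lerD2l; exact: rC.
  elim: n => [|n IH]; first by rewrite /s big_ord0 addr0.
  by rewrite /s big_ord_recr/= -/(s n); have := ar n; rewrite ler_norml; lra.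
have ca2 : cvgn (fun n => a n ^+ 2).
  rewrite (_ : (fun n => _) = (fun n => (a n ^+ 2 + s n) - s n)).
    exact: is_cvgB.
  by apply/funext => n; rewrite addrK.
pose l := limn (fun n => a n ^+ 2).
have la2 : (fun n => a n ^+ 2) @ \oo --> l by exact: ca2.
have l0 : 0 <= l by apply: limr_ge => //; apply: nearW => n; exact: sqr_ge0.
have cvga : a @ \oo --> Num.sqrt l.
  rewrite (_ : a = Num.sqrt \o (fun n => a n ^+ 2)).
    by apply: continuous_cvg la2; exact: sqrt_continuous.
  by apply/funext => n /=; rewrite sqrtr_sqr ger0_norm.
have [sl0|sl0] := eqVneq (Num.sqrt l) 0; first by rewrite sl0 in cvga.
have slp : 0 < Num.sqrt l by rewrite lt_neqAle eq_sym sl0 sqrtr_ge0.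
have [N _ Na] : \forall n \near \oo, Num.sqrt l / 2 < a n.
  by apply: (cvgr_gt _ cvga); rewrite ltr_pdivrMr// ltr_pMr// ltr1n.
have [n nB] := gsum (\sum_(k < N) g k + B / (Num.sqrt l / 2)).
have tail i : (\sum_(k < N + i) g k) * (Num.sqrt l / 2) <=
    (\sum_(k < N) g k) * (Num.sqrt l / 2) + \sum_(k < N + i) g k * a k.
  elim: i => [|i IH].
    by rewrite addn0 lerDl; apply: sumr_ge0 => k _; rewrite mulr_ge0// ltW.
  rewrite addnS !big_ord_recr/= mulrDl addrA lerD//.
  by rewrite ler_wpM2l// ltW// Na//= leq_addr.
(* The index n need not exceed N, the rank from which a_k stays above half its limit; replacing it
   by N + n only enlarges the sum. The steps after N then contribute more than B to the sum of the
   g_k a_k. *)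
have {}nB : \sum_(k < N) g k + B / (Num.sqrt l / 2) < \sum_(k < N + n) g k.
  apply: lt_le_trans nB _; rewrite addnC big_split_ord/= lerDl.
  by apply: sumr_ge0 => k _; rewrite ltW.
have sl2 : 0 < Num.sqrt l / 2 by rewrite divr_gt0.
have h1 := tail n; have h2 := gaB (N + n)%N.
move: nB; rewrite -(ltr_pM2r sl2) mulrDl divfK ?gt_eqF//; lra.
Qed.

End deterministic_limit.

(** * Means of random convex functions and of their subgradients *)

Section real_expectation.
Context {d : measure_display} {Om : measurableType d} {R : realType}.
Variable P : probability Om R.
Implicit Types (h u v : Om -> R) (a b c : R).

(** Keeps integrability and the value together, so that linear combinations carry their
    integrability with them. *)
Definition has_mean h c := P.-integrable [set: Om] (EFin \o h) /\ \int[P]_o h o = c.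

Lemma has_mean_integrable h : P.-integrable [set: Om] (EFin \o h) ->
  has_mean h (fine 'E_P[h]).
Proof. by split=> //; rewrite unlock. Qed.

Lemma has_mean_cst c : has_mean (fun=> c) c.
Proof.
split; first exact: finite_measure_integrable_cst.
rewrite Rintegral_cst// [X in fine X](_ : _ = 1%E) ?mulr1//.
exact: probability_setT.
Qed.

Lemma has_meanD u v a b : has_mean u a -> has_mean v b ->
  has_mean (fun o => u o + v o) (a + b).
Proof.
move=> [iu <-] [iv <-]; split; last exact: RintegralD.
exact: (integrableD _ iu iv).
Qed.

Lemma has_meanZ k u a : has_mean u a -> has_mean (fun o => k * u o) (k * a).
Proof.
move=> [iu <-]; split; last exact: RintegralZl.
exact: (integrableZl _ k iu).
Qed.

Lemma has_meanN u a : has_mean u a -> has_mean (fun o => - u o) (- a).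
Proof.
move=> /(has_meanZ (-1)); rewrite mulN1r; congr has_mean.
by apply/funext => o; rewrite mulN1r.
Qed.

Lemma has_meanB u v a b : has_mean u a -> has_mean v b ->
  has_mean (fun o => u o - v o) (a - b).
Proof. by move=> hu /has_meanN; exact: has_meanD. Qed.

Lemma has_mean_sum (I : Type) (r : seq I) (u : I -> Om -> R) (a : I -> R) :
  (forall i, has_mean (u i) (a i)) ->
  has_mean (fun o => \sum_(i <- r) u i o) (\sum_(i <- r) a i).
Proof.
move=> ua; elim: r => [|i r IH].
  rewrite big_nil; under eq_fun do rewrite big_nil.
  exact: has_mean_cst.
rewrite big_cons; under eq_fun do rewrite big_cons.
exact: has_meanD.
Qed.

Lemma has_mean_le u v a b : has_mean u a -> has_mean v b ->
  (forall o, u o <= v o) -> a <= b.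
Proof. by move=> [iu <-] [iv <-] uv; apply: le_Rintegral. Qed.

Lemma has_mean_integral u a : has_mean u a -> (\int[P]_o (u o)%:E = a%:E)%E.
Proof.
by move=> [iu <-]; rewrite /Rintegral fineK//; exact: integrable_fin_num.
Qed.

Lemma has_mean_ge0 u c : measurable_fun [set: Om] u -> (forall o, 0 <= u o) ->
  (\int[P]_o (u o)%:E <= c%:E)%E -> exists2 a, has_mean u a & a <= c.
Proof.
move=> mu u0 uc.
have iu : P.-integrable [set: Om] (EFin \o u).
  apply/integrableP; split; first exact/measurable_EFinP.
  under eq_integral do rewrite /= ger0_norm//.
  exact: le_lt_trans (ltry c).
exists (\int[P]_o u o) => //.
by rewrite -lee_fin /Rintegral fineK//; exact: integrable_fin_num.
Qed.

Lemma le_integrable_real u v : measurable_fun [set: Om] u ->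
  P.-integrable [set: Om] (EFin \o v) -> (forall o, `|u o| <= `|v o|) ->
  P.-integrable [set: Om] (EFin \o u).
Proof.
move=> mu iv uv; apply: le_integrable iv => //; first exact/measurable_EFinP.
by move=> o _; rewrite lee_fin.
Qed.

(** Integrability comes from |u| <= 1 + u^2. The inequality for the squared mean e is the average of
    the tangent-line bound 2eu - e^2 <= u^2. *)
Lemma has_mean_of_sqr u c : measurable_fun [set: Om] u ->
  (\int[P]_o ((u o) ^+ 2)%:E <= c%:E)%E ->
  has_mean u (fine 'E_P[u]) /\ (fine 'E_P[u]) ^+ 2 <= c.
Proof.
move=> mu uc.
have [a [iu2 u2a] ac] := has_mean_ge0 (measurable_funX 2 mu)
  (fun o => sqr_ge0 (u o)) uc.
have iu : P.-integrable [set: Om] (EFin \o u).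
  have [i1 _] := has_meanD (has_mean_cst 1) (conj iu2 erefl).
  apply: le_integrable_real i1 _ => // o.
  rewrite [X in _ <= X]ger0_norm ?addr_ge0 ?sqr_ge0//.
  by rewrite ler_norml; apply/andP; split; nra.
have hu := has_mean_integrable iu; split=> //.
move: (fine _) hu => e hu; apply: le_trans ac.
have := has_mean_le (has_meanB (has_meanZ (2 * e) hu) (has_mean_cst (e ^+ 2)))
  (conj iu2 u2a).
have h o : 2 * e * u o - e ^+ 2 <= u o ^+ 2 by have := sqr_ge0 (u o - e); nra.
by move=> /(_ h); nra.
Qed.

End real_expectation.

Section vector_moments.
Context {d : measure_display} {Om : measurableType d} {R : realType} {n : nat}.
Variables (P : probability Om R) (v : Om -> 'cV[R]_n) (s C : R).
Hypothesis mv : measurable_coords v.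
Hypothesis varv : variance_le P v s.

Let centered_moment :
  exists2 a, has_mean P (fun o => dot (v o - mean_cV P v) (v o - mean_cV P v)) a
           & a <= s ^+ 2.
Proof.
apply: has_mean_ge0.
- have mvc : measurable_coords (fun o => v o - mean_cV P v).
    by apply: measurable_coordsB => //; exact: measurable_coords_cst.
  exact: measurable_dot.
- by move=> o; exact: dot_ge0.
- move: varv; rewrite /variance_le unlock.
  by under eq_integral do rewrite enorm_sqr.
Qed.

(** The coordinate is dominated by 1 + |e| + |v - mean|^2, where e is the coordinate of [mean_cV].
    This domination holds for any centre, so it applies before that centre is known to be a true
    mean. *)
Lemma has_mean_coord j : has_mean P (fun o => v o j 0) (mean_cV P v j 0).
Proof.
rewrite mxE; apply: has_mean_integrable.
have [a ha _] := centered_moment.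
have [i1 _] := has_meanD (has_mean_cst P (1 + `|mean_cV P v j 0|)) ha.
apply: le_integrable_real i1 _ => // o.
rewrite [X in _ <= X]ger0_norm ?addr_ge0 ?dot_ge0//.
have := coord_sqr_le (v o - mean_cV P v) j; rewrite !mxE.
move: (dot _ _) (v o j 0) (fine _) => D x e xeD.
have := sqr_ge0 (`|x - e| - 1); have := ler_normD (x - e) e.
rewrite subrK; have := real_normK (num_real (x - e)).
move: xeD; move: ((x - e) ^+ 2) `|x - e| `|x| `|e| => A b c f; nra.
Qed.

(** From |v|^2 <= 2 |v - E v|^2 + 2 |E v|^2: the variance bounds one part and the norm of the mean
    the other. *)
Lemma second_moment_le : enorm (mean_cV P v) <= C ->
  exists2 a, has_mean P (fun o => dot (v o) (v o)) a & a <= 2 * s ^+ 2 + 2 * C ^+ 2.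
Proof.
move=> vC; have [a ha a_s] := centered_moment.
have cC : dot (mean_cV P v) (mean_cV P v) <= C ^+ 2.
  by rewrite -enorm_le_sqr// (le_trans (enorm_ge0 _) vC).
have hb := has_meanD (has_meanZ 2 ha)
  (has_mean_cst P (2 * dot (mean_cV P v) (mean_cV P v))).
have vb o : dot (v o) (v o) <= 2 * dot (v o - mean_cV P v) (v o - mean_cV P v) +
    2 * dot (mean_cV P v) (mean_cV P v).
  have := dot_ge0 (v o - mean_cV P v - mean_cV P v).
  rewrite !dotE !(dotC _ (v o)); lra.
have iv : P.-integrable [set: Om] (EFin \o (fun o => dot (v o) (v o))).
  apply: le_integrable_real hb.1 _ => [|o]; first exact: measurable_dot.
  by rewrite !ger0_norm ?dot_ge0// (le_trans (dot_ge0 _) (vb o)).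
exists (\int[P]_o dot (v o) (v o)) => //.
by apply: le_trans (has_mean_le (conj iv erefl) hb vb) _; nra.
Qed.

End vector_moments.

(** Joint measurability is available on [X] only. A closed [X] is Borel, so the composition is
    measurable as long as the point stays in [X]. *)
Lemma jointly_measurable_comp (d : measure_display) (Om : measurableType d)
    (R : realType) (n : nat) (X : set 'cV[R]_n) (h : Om -> 'cV[R]_n -> R)
    (d' : measure_display) (S : measurableType d') (o : S -> Om)
    (x : S -> 'cV[R]_n) :
  closed X -> jointly_measurable X h -> measurable_fun [set: S] o ->
  (forall j, measurable_fun [set: S] (fun s => x s j 0)) -> (forall s, X (x s)) ->
  measurable_fun [set: S] (fun s => h (o s) (x s)).
Proof.
move=> cX mh mo mx Xx.
have mX : measurable (X : set (borel_cV R n)).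
  rewrite -[X]setCK; apply: measurableC; apply: sub_sigma_algebra.
  exact: closed_openC.
have mD : measurable ([set: Om] `*` X : set (Om * borel_cV R n)) by exact: measurableX.
apply: (@measurable_comp _ _ _ S (Om * borel_cV R n)%type R _
  (fun p => h p.1 p.2) [set: S] (fun s => (o s, x s)) mD _ mh).
- by move=> _ [s _ <-]; split=> //=; exact: Xx.
- by apply: measurable_fun_pair => //; exact: measurable_borel_cV.
Qed.

(** * Subgradients of the mean function *)

Section mean_subgradient.
Context {d : measure_display} {Om : measurableType d} {R : realType} {n : nat}.
Variables (P : probability Om R) (D X : set 'cV[R]_n).
Variables (h : Om -> 'cV[R]_n -> R) (dh : Om -> 'cV[R]_n -> 'cV[R]_n).
Variables (C s : R).
Hypotheses (closedX : closed X) (subXD : X `<=` D).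
Hypotheses (convex_h : random_convex P D h) (oracle_h : subgradient_oracle D X h dh).
Hypothesis bounded_h : forall x s, X x ->
  subdifferential D (mean P h) x s -> enorm s <= C.
Hypothesis variance_h : forall x, X x -> variance_le P (dh ^~ x) s.

Lemma has_mean_section x : D x -> has_mean P (h ^~ x) (mean P h x).
Proof. by move=> Dx; apply: has_mean_integrable; exact: convex_h.2. Qed.

Let mdh x j : X x -> measurable_fun [set: Om] (fun o => dh o x j 0).
Proof.
move=> Xx; apply: (@jointly_measurable_comp _ _ _ _ X (fun o x => dh o x j 0)) => //.
exact: oracle_h.2.
Qed.

(** Averaging the pointwise subgradient inequality. This is the link between the oracle and the
    bound [C], which concerns subgradients of the mean function. *)
Lemma subdifferential_mean x : X x ->
  subdifferential D (mean P h) x (mean_cV P (dh ^~ x)).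
Proof.
move=> Xx y Dy.
have hdot : has_mean P (fun o => dot (dh o x) (y - x))
    (dot (mean_cV P (dh ^~ x)) (y - x)).
  under eq_fun do rewrite dotC.
  rewrite dotC /dot.
  apply: has_mean_sum => j; apply: has_meanZ.
  by apply: (has_mean_coord _ (variance_h Xx)) => j'; exact: mdh.
apply: has_mean_le (has_meanD (has_mean_section (subXD Xx)) hdot)
  (has_mean_section Dy) _ => o.
exact: oracle_h.1.
Qed.

Lemma enorm_mean_subgradient x : X x -> enorm (mean_cV P (dh ^~ x)) <= C.
Proof. by move=> Xx; apply: bounded_h (subdifferential_mean Xx). Qed.

(** The mean subgradient at one point, tested at the other, bounds the difference in one direction;
    exchanging the points gives the other direction. *)
Lemma mean_lipschitz x y : X x -> X y ->
  `|mean P h x - mean P h y| <= C * enorm (x - y).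
Proof.
have half u v : X u -> X v -> mean P h u - mean P h v <= C * enorm (u - v).
  move=> Xu Xv; have := subdifferential_mean Xu (subXD Xv).
  have := dot_le_enorm (mean_cV P (dh ^~ u)) (u - v).
  have := enorm_mean_subgradient Xu; have := enorm_ge0 (u - v).
  rewrite -[v - u]opprB dotNr; nra.
move=> Xx Xy; rewrite ler_norml lerNl opprB half// andbT.
by rewrite (le_trans (half _ _ Xy Xx))// -[y - x]opprB /enorm dotNl dotNr opprK.
Qed.

Lemma subgradient_second_moment x : X x ->
  exists2 a, has_mean P (fun o => dot (dh o x) (dh o x)) a &
             a <= 2 * s ^+ 2 + 2 * C ^+ 2.
Proof.
move=> Xx; apply: second_moment_le (variance_h Xx) (enorm_mean_subgradient Xx).
by move=> j; exact: mdh.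
Qed.

End mean_subgradient.

(** Here [a] and [a'] are successive gaps, [c] the step size, [p] and [q] the norms of the two
    stochastic vectors, [y] the energy and [M] its bound along the path. In |a'^2 - a^2| <= |a' - a|
    (2a + |a' - a|), the linear part uses p + q <= 1 + p^2 + q^2 and yields L, the quadratic part
    uses (p + q)^2 <= 2 (p^2 + q^2) and yields 2 L^2. The factor M compensates the division by y. *)
Lemma sqr_increment_le (R : realFieldType) (a a' L c p q y M : R) :
  0 <= a -> 0 <= L -> 0 < c -> 0 <= p -> 0 <= q -> 1 <= y -> y <= M ->
  `|a' - a| <= L * (c * p + c * q) ->
  `|a' ^+ 2 - a ^+ 2| <= (L + 2 * L ^+ 2) * M *
    ((2 * c * a + c ^+ 2) / y * (p ^+ 2 + q ^+ 2) + 2 * c * a).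
Proof.
move=> a0 L0 c0 p0 q0 y1 yM del.
have y0 : 0 < y by rewrite (lt_le_trans ltr01).
set u := _ / y * _ + _.
have ca0 : 0 <= 2 * c * a by rewrite !mulr_ge0// ltW.
have Mu : (2 * c * a + c ^+ 2) * (p ^+ 2 + q ^+ 2) + 2 * c * a <= M * u.
  have h0 : 0 <= (2 * c * a + c ^+ 2) * (p ^+ 2 + q ^+ 2).
    by rewrite mulr_ge0// addr_ge0// sqr_ge0.
  rewrite /u [leRHS]mulrDr; apply: lerD.
    have -> (A B : R) : M * (A / y * B) = M / y * (A * B) by ring.
    by rewrite ler_peMl// ler_pdivlMr// mul1r.
  by rewrite ler_peMl// (le_trans y1).
move: u Mu => u Mu.
have e0 : 0 <= p ^+ 2 + q ^+ 2 by rewrite addr_ge0// sqr_ge0.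
have pq : p + q <= 1 + (p ^+ 2 + q ^+ 2).
  by have := sqr_ge0 (p - 1); have := sqr_ge0 (q - 1); nra.
have pq2 : (p + q) ^+ 2 <= 2 * (p ^+ 2 + q ^+ 2).
  by have := sqr_ge0 (p - q); nra.
rewrite -mulrDr mulrA in del.
have -> : a' ^+ 2 - a ^+ 2 = (a' - a) * (2 * a + (a' - a)) by ring.
rewrite normrM.
apply: (@le_trans _ _ (L * c * (p + q) * (2 * a + L * c * (p + q)))).
  apply: ler_pM => //; apply: le_trans (ler_normD _ _) _.
  by rewrite lerD// ger0_norm// mulr_ge0.
move: (p ^+ 2 + q ^+ 2) e0 pq pq2 Mu => e e0 pq pq2 Mu.
have pq0 : 0 <= p + q by rewrite addr_ge0.
move: (p + q) pq0 pq pq2 => s s0 se s2e.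
have h1 : 2 * c * a * s <= 2 * c * a * (1 + e) by rewrite ler_wpM2l.
have h2 : c ^+ 2 * s ^+ 2 <= c ^+ 2 * (2 * e) by rewrite ler_wpM2l// sqr_ge0.
have h3 : 0 <= 2 * c * a * e by rewrite mulr_ge0.
have h4 : 0 <= c ^+ 2 * e by rewrite mulr_ge0// sqr_ge0.
have k1 : L * (2 * c * a * s) <= L * (M * u) by rewrite ler_wpM2l//; lra.
have k2 : L ^+ 2 * (c ^+ 2 * s ^+ 2) <= L ^+ 2 * (2 * (M * u)).
  by rewrite ler_wpM2l ?sqr_ge0//; lra.
have -> : L * c * s * (2 * a + L * c * s) = L * (2 * c * a * s) + L ^+ 2 * (c ^+ 2 * s ^+ 2).
  by ring.
have -> : (L + 2 * L ^+ 2) * M * u = L * (M * u) + L ^+ 2 * (2 * (M * u)) by ring.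
exact: lerD.
Qed.

(** * The primal-dual method *)

Section primal_dual_method.
Context {R : realType} {n m : nat} {d : measure_display} {Om : measurableType d}.
Variables (P : probability Om R) (D X : set 'cV[R]_n).
Variables (f : Om -> 'cV[R]_n -> R) (g : 'I_m -> Om -> 'cV[R]_n -> R).
Variables (df : Om -> 'cV[R]_n -> 'cV[R]_n) (dg : 'I_m -> Om -> 'cV[R]_n -> 'cV[R]_n).
Hypotheses (closedX : closed X) (convexX : @convex_set R 'cV[R]_n X).
Hypothesis subXD : X `<=` D.
Hypotheses (convex_f : random_convex P D f) (convex_g : forall i, random_convex P D (g i)).
Hypothesis meas_g : forall i, jointly_measurable X (g i).
Hypothesis oracle_f : subgradient_oracle D X f df.
Hypothesis oracle_g : forall i, subgradient_oracle D X (g i) (dg i).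
Variables (C_F sigma_F : R) (C_G sigma_G D_G : 'I_m -> R).
Hypothesis bounded_F : forall x s, X x ->
  subdifferential D (mean P f) x s -> enorm s <= C_F.
Hypothesis bounded_G : forall i x s, X x ->
  subdifferential D (mean P (g i)) x s -> enorm s <= C_G i.
Hypothesis variance_F : forall x, X x -> variance_le P (df ^~ x) sigma_F.
Hypothesis variance_G : forall i x, X x -> variance_le P (dg i ^~ x) (sigma_G i).
Hypothesis moment_G : forall i x, X x ->
  ('E_P[fun w => (`|g i w x| ^+ 2)%R] <= (D_G i ^+ 2)%:E)%E.
Variables (xs : 'cV[R]_n) (zs : 'cV[R]_m).
Hypothesis saddle : saddle_point (mean P f) (fun i => mean P (g i)) X xs zs.

Local Notation F := (mean P f).
Local Notation G := (fun i => mean P (g i)).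

Definition direction (o : Om) (x : 'cV[R]_n) (z : 'cV[R]_m) : 'cV[R]_n :=
  df o x + \sum_(i < m) z i 0 *: dg i o x.

Definition gap x z := lagrangian F G x zs - lagrangian F G xs z.

(** The summand 1 lets constants be absorbed into multiples of the energy and makes division by it
    safe. *)
Definition energy (x : 'cV[R]_n) (z : 'cV[R]_m) : R :=
  1 + dot (x - xs) (x - xs) + dot (z - zs) (z - zs).

Let Xxs : X xs. Proof. by case: saddle. Qed.

Lemma gap_ge0 x z : X x -> orthant z -> 0 <= gap x z.
Proof.
case: saddle => _ zs0 h Xx z0.
have /andP[h1 _] := h x z Xx z0; have /andP[_ h2] := h x z Xx z0.
by rewrite subr_ge0 (le_trans h1 h2).
Qed.

Lemma energy_ge1 x z : 1 <= energy x z.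
Proof. by rewrite /energy -addrA lerDl addr_ge0// dot_ge0. Qed.

(** In x the gap is F plus a fixed combination of the G^i with coefficients [zs]; in z it is affine
    with slope -G(xs). Absolute values guard against negative constants [C_F] and [C_G i]. *)
Lemma gap_lipschitz : exists2 L, 0 <= L & forall x x' z z', X x -> X x' ->
  `|gap x' z' - gap x z| <= L * (enorm (x' - x) + enorm (z' - z)).
Proof.
pose L1 := `|C_F| + \sum_i `|zs i 0| * `|C_G i|.
pose L2 := \sum_i `|G i xs|.
have L10 : 0 <= L1 by rewrite addr_ge0// sumr_ge0.
have L20 : 0 <= L2 by rewrite sumr_ge0.
exists (L1 + L2); first exact: addr_ge0.
move=> x x' z z' Xx Xx'.
have -> : gap x' z' - gap x z = (F x' - F x) +
    \sum_i zs i 0 * (G i x' - G i x) - \sum_i (z' - z) i 0 * G i xs.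
  rewrite /gap /lagrangian /dot.
  under eq_bigr do rewrite mxE.
  under [X in _ - (_ + X) - _]eq_bigr do rewrite mxE.
  under [X in _ - _ - (_ + X - _)]eq_bigr do rewrite mxE.
  under [X in _ - _ - (_ - (_ + X))]eq_bigr do rewrite mxE.
  under [X in _ = _ + X - _]eq_bigr do rewrite mulrBr.
  under [X in _ = _ + _ - X]eq_bigr do rewrite !mxE mulrBl.
  rewrite !sumrB; lra.
have F1 : `|F x' - F x| <= `|C_F| * enorm (x' - x).
  apply: le_trans (mean_lipschitz closedX subXD convex_f oracle_f bounded_F variance_F Xx' Xx) _.
  by rewrite ler_wpM2r ?enorm_ge0// ler_norm.
have G1 : `|\sum_i zs i 0 * (G i x' - G i x)| <=
    (\sum_i `|zs i 0| * `|C_G i|) * enorm (x' - x).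
  apply: le_trans (ler_norm_sum _ _ _) _; rewrite mulr_suml; apply: ler_sum => i _.
  rewrite normrM -mulrA ler_wpM2l//.
  apply: le_trans (mean_lipschitz closedX subXD (convex_g i) (oracle_g i)
    (@bounded_G i) (@variance_G i) Xx' Xx) _.
  by rewrite ler_wpM2r ?enorm_ge0// ler_norm.
have Z1 : `|\sum_i (z' - z) i 0 * G i xs| <= L2 * enorm (z' - z).
  apply: le_trans (ler_norm_sum _ _ _) _; rewrite mulr_suml; apply: ler_sum => i _.
  by rewrite normrM mulrC ler_wpM2l// coord_le_enorm.
have x0 := enorm_ge0 (x' - x); have z0 := enorm_ge0 (z' - z).
apply: le_trans (ler_normB _ _) _; apply: le_trans (lerD (ler_normD _ _) Z1) _.
apply: le_trans (lerD (lerD F1 G1) (lexx _)) _.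
rewrite -mulrDl -/L1; have := mulr_ge0 L10 z0; have := mulr_ge0 L20 x0.
by rewrite mulrDr !(mulrDl L1 L2) => h1 h2; lra.
Qed.

(** Measures the cost of evaluating the constraint at the new primal point instead of the old one,
    with [a] the distance vector of the multiplier from [zs]. *)
Lemma constraint_cross_term : exists2 c, 0 <= c & forall a x x', X x -> X x' ->
  dot a (\col_i G i x') - dot a (\col_i G i x) <= c * (enorm a * enorm (x' - x)).
Proof.
exists (\sum_i `|C_G i|); first by rewrite sumr_ge0.
move=> a x x' Xx Xx'; rewrite -sumrB mulr_suml; apply: ler_sum => i _.
rewrite !mxE -mulrBr; apply: le_trans (ler_norm _) _; rewrite normrM mulrCA.
rewrite ler_pM ?coord_le_enorm//.
apply: le_trans (mean_lipschitz closedX subXD (convex_g i) (oracle_g i)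
  (@bounded_G i) (@variance_G i) Xx' Xx) _.
by rewrite ler_wpM2r ?enorm_ge0// ler_norm.
Qed.

(** The direction is affine in z, so its second moment is at most a constant plus a multiple of
    |z|^2, and |z|^2 <= 2 |z - zs|^2 + 2 |zs|^2 is controlled by the energy. A dominating function
    [B] with known mean is all that later integrations use. *)
Lemma direction_moment : exists2 c, 0 <= c & forall x z, X x ->
  exists B b, [/\ has_mean P B b,
    forall o, dot (direction o x z) (direction o x z) <= B o & b <= c * energy x z].
Proof.
pose cF := 2 * sigma_F ^+ 2 + 2 * C_F ^+ 2.
pose cG i := 2 * sigma_G i ^+ 2 + 2 * C_G i ^+ 2.
have cF0 : 0 <= cF by rewrite addr_ge0// mulr_ge0// sqr_ge0.
have cG0 i : 0 <= cG i by rewrite addr_ge0// mulr_ge0// sqr_ge0.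
pose c1 := 2 * cF; pose c2 := 2 * (m%:R * \sum_i cG i).
have c10 : 0 <= c1 by rewrite mulr_ge0.
have c20 : 0 <= c2 by rewrite !mulr_ge0// sumr_ge0.
pose c := c1 + c2 * (2 + 2 * dot zs zs).
have zs0 := dot_ge0 zs.
exists c; first by rewrite addr_ge0// mulr_ge0// addr_ge0// mulr_ge0.
move=> x z Xx.
have [bF hF bFc] := subgradient_second_moment closedX subXD convex_f oracle_f
  bounded_F variance_F Xx.
have hG i := subgradient_second_moment closedX subXD (convex_g i) (oracle_g i)
  (@bounded_G i) (@variance_G i) Xx.
have [bG hbG] : exists bG : 'I_m -> R, forall i,
    has_mean P (fun o => dot (dg i o x) (dg i o x)) (bG i) /\ bG i <= cG i.
  have [bG hbG] := choice (fun i => let: ex_intro2 a h1 h2 := hG i in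
    ex_intro (fun b => has_mean P (fun o => dot (dg i o x) (dg i o x)) b /\ b <= cG i)
      a (conj h1 h2)).
  by exists bG.
have hB := has_meanD (has_meanZ 2 hF) (has_meanZ 2 (has_meanZ m%:R
  (has_mean_sum (index_enum 'I_m) (fun i => has_meanZ (z i 0 ^+ 2) (hbG i).1)))).
eexists; eexists; split; first exact: hB.
- move=> o; rewrite /direction.
  set u := df o x; set v := \sum_i _.
  apply: (@le_trans _ _ (2 * dot u u + 2 * dot v v)).
    have := dot_ge0 (u - v); move: u v => u v; rewrite !dotE (dotC v u); lra.
  rewrite lerD2l ler_pM2l//; apply: le_trans (dot_sum_le _) _.
  rewrite card_ord ler_wpM2l// ler_sum// => i _.
  by rewrite dotZl dotZr mulrA -expr2.
- have zz : dot z z <= (2 + 2 * dot zs zs) * energy x z - 1.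
    have := dot_ge0 (z - zs - zs); have := dot_ge0 (z - zs).
    have := dot_ge0 (x - xs); rewrite /energy.
    have : dot z z <= 2 * dot (z - zs) (z - zs) + 2 * dot zs zs.
      have := dot_ge0 (z - zs - zs); rewrite !dotE !(dotC zs z); lra.
    move: zs0; move: (dot (x - xs) (x - xs)) (dot (z - zs) (z - zs)) (dot zs zs) => A B c0; nra.
  have sG : \sum_i z i 0 ^+ 2 * bG i <= dot z z * \sum_i cG i.
    rewrite mulr_sumr; apply: ler_sum => i _.
    have bG0 : 0 <= bG i.
      by apply: has_mean_le (has_mean_cst P 0) (hbG i).1 _ => o; exact: dot_ge0.
    by apply: ler_pM; rewrite ?sqr_ge0 ?coord_sqr_le//; exact: (hbG i).2.
  have E1 := energy_ge1 x z.
  apply: (@le_trans _ _ (c1 + c2 * dot z z)).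
    apply: lerD; first by rewrite ler_pM2l.
    rewrite /c2 -[leRHS]mulrA ler_pM2l// -[leRHS]mulrA ler_wpM2l//.
    by rewrite [leRHS]mulrC.
  rewrite /c mulrDl; apply: lerD; first by rewrite ler_peMr.
  by rewrite -[leRHS]mulrA ler_wpM2l// (le_trans zz)// lerBlDr lerDl.
Qed.

Definition constraint (o : Om) (x : 'cV[R]_n) : 'cV[R]_m := \col_i g i o x.

Local Notation meanG x := (\col_i mean P (g i) x).

Definition moment_bound : R := \sum_i D_G i ^+ 2.

Lemma constraint_moments i x : X x ->
  (mean P (g i) x) ^+ 2 <= D_G i ^+ 2 /\
  exists2 b, has_mean P (fun o => g i o x ^+ 2) b & b <= D_G i ^+ 2.
Proof.
move=> Xx.
have mgx : measurable_fun [set: Om] (fun o => g i o x).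
  exact: (@jointly_measurable_comp _ _ _ _ X (g i)).
have gx2 : (\int[P]_o (g i o x ^+ 2)%:E <= (D_G i ^+ 2)%:E)%E.
  have := moment_G i Xx; rewrite unlock.
  by under eq_integral do rewrite real_normK ?num_real//.
split; last by apply: has_mean_ge0 gx2 => [|o]; [exact: measurable_funX|exact: sqr_ge0].
by have [_] := has_mean_of_sqr mgx gx2.
Qed.

Lemma constraint_second_moment x : X x ->
  exists2 b, has_mean P (fun o => dot (constraint o x) (constraint o x)) b
           & b <= moment_bound.
Proof.
move=> Xx; have [b hb] := choice (fun i =>
  let: conj _ (ex_intro2 b h1 h2) := constraint_moments i Xx in
  ex_intro (fun b => has_mean P (fun o => g i o x ^+ 2) b /\ b <= D_G i ^+ 2)
    b (conj h1 h2)).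
exists (\sum_i b i); last by apply: ler_sum => i _; exact: (hb i).2.
have := has_mean_sum (index_enum 'I_m) (fun i => (hb i).1).
congr (has_mean _ _ _); apply/funext => o.
by apply: eq_bigr => i _; rewrite mxE.
Qed.

(** Expanding the square, the cross term averages to the mean constraint. It is applied with the new
    primal point frozen, as that point does not depend on the second sample. *)
Lemma dual_expected_step (a : 'cV[R]_m) c x : X x ->
  exists2 b, has_mean P (fun o => dot (a + c *: constraint o x) (a + c *: constraint o x)) b
    & b <= dot a a + 2 * c * dot a (meanG x) + c ^+ 2 * moment_bound.
Proof.
move=> Xx; have [b hb bD] := constraint_second_moment Xx.
have hG : has_mean P (fun o => dot a (constraint o x)) (dot a (meanG x)).
  have := has_mean_sum (index_enum 'I_m) (fun i =>
    has_meanZ (a i 0) (has_mean_section (convex_g i) (subXD Xx))).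
  congr (has_mean _ _ _); first by apply/funext => o; apply: eq_bigr => i _; rewrite mxE.
  by apply: eq_bigr => i _; rewrite mxE.
have h := has_meanD (has_meanD (has_mean_cst P (dot a a)) (has_meanZ (2 * c) hG))
  (has_meanZ (c ^+ 2) hb).
exists (dot a a + 2 * c * dot a (meanG x) + c ^+ 2 * b).
  congr (has_mean _ _ _): h; apply/funext => o.
  by rewrite !dotE (dotC _ a); ring.
by rewrite lerD2l ler_wpM2l// sqr_ge0.
Qed.

(* Dominates the energy after both half-steps, averaged over the second sample. *)
Definition half_step_energy (cG c : R) (o : Om) x z : R :=
  1 + dot (x - c *: direction o x z - xs) (x - c *: direction o x z - xs)
  + dot (z - zs + c *: meanG x) (z - zs + c *: meanG x)
  + c ^+ 2 * (cG * (dot (z - zs) (z - zs) + dot (direction o x z) (direction o x z))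
              + moment_bound).

Lemma moment_bound_ge0 : 0 <= moment_bound.
Proof. by apply: sumr_ge0 => i _; exact: sqr_ge0. Qed.

Lemma half_step_energy_ge0 cG c o x z : 0 <= cG -> 0 <= half_step_energy cG c o x z.
Proof.
move=> cG0; rewrite /half_step_energy.
have := dot_ge0 (x - c *: direction o x z - xs).
have := dot_ge0 (z - zs + c *: meanG x).
have := dot_ge0 (z - zs); have := dot_ge0 (direction o x z).
move=> h1 h2 h3 h4; rewrite !addr_ge0// mulr_ge0 ?sqr_ge0// addr_ge0//.
  by rewrite mulr_ge0// addr_ge0.
exact: moment_bound_ge0.
Qed.

(** The constraint at [x'] is traded for the one at [x]: the difference is at most 2 c^2 cG |z - zs|
    |direction|, which splits by the arithmetic-geometric mean inequality. Completing the square
    with c G(x) only enlarges the bound and keeps it visibly nonnegative, as Tonelli requires. *)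
Lemma energy_half_step cG c o x x' z : 0 < c ->
  (forall a x x', X x -> X x' ->
    dot a (meanG x') - dot a (meanG x) <= cG * (enorm a * enorm (x' - x))) ->
  0 <= cG -> X x -> X x' ->
  dot (x' - xs) (x' - xs) <=
    dot (x - c *: direction o x z - xs) (x - c *: direction o x z - xs) ->
  enorm (x' - x) <= c * enorm (direction o x z) ->
  1 + dot (x' - xs) (x' - xs) + (dot (z - zs) (z - zs)
    + 2 * c * dot (z - zs) (meanG x') + c ^+ 2 * moment_bound) <=
  half_step_energy cG c o x z.
Proof.
move=> c0 cGP cG0 Xx Xx' x'P stepP.
have cross := cGP (z - zs) x x' Xx Xx'.
rewrite /half_step_energy; move: (direction o x z) x'P stepP => v x'P stepP.
move: (z - zs) cross => a cross.
have aG : dot a a + 2 * c * dot a (meanG x) <=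
    dot (a + c *: meanG x) (a + c *: meanG x).
  have := dot_ge0 (meanG x).
  rewrite !dotE (dotC _ a); move: (dot (meanG x) _) => g2 g20; nra.
have av : c * (dot a (meanG x') - dot a (meanG x)) * 2 <=
    c ^+ 2 * (cG * (dot a a + dot v v)).
  apply: (@le_trans _ _ (c * (cG * (enorm a * (c * enorm v))) * 2)).
    rewrite ler_pM2r// ler_pM2l//; apply: le_trans cross _.
    by rewrite ler_wpM2l// ler_wpM2l// enorm_ge0.
  rewrite -!enorm_sqr; have := sqr_ge0 (enorm a - enorm v).
  move: (enorm a) (enorm v) => A V h.
  have := mulr_ge0 (mulr_ge0 (sqr_ge0 c) cG0) h; nra.
move: (dot (x' - xs) _) (dot (x - _ - _) _) x'P (dot (a + _) _) aG av => *.
rewrite mulrDr; lra.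
Qed.

(** Convexity is used sample by sample, before averaging: with z >= 0, the inner product of the
    direction with x - xs dominates a difference of function values whose mean is that of the
    Lagrangian L(., z). *)
Lemma primal_expected_step cG : 0 <= cG -> exists2 K, 0 <= K &
  forall c x z, 0 < c -> X x -> orthant z ->
  exists B b, [/\ has_mean P B b, forall o, half_step_energy cG c o x z <= B o &
    b <= (1 + K * c ^+ 2) * energy x z - 2 * c * gap x z].
Proof.
move=> cG0; have [cd cd0 dirP] := direction_moment.
have D20 := moment_bound_ge0.
(* The part (1 + cG) cd comes from the squared direction, in the primal square and in the cross
   term; cG from |z - zs|^2 in the cross term; the moment bound occurs twice, for the sampled
   constraint and for |G(x)|^2 from the completed square. *)
pose K := (1 + cG) * cd + cG + 2 * moment_bound.
exists K; first by rewrite !addr_ge0// mulr_ge0// addr_ge0.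
move=> c x z c0 Xx z0.
have [B [b [hB dB bc]]] := dirP x z Xx.
have hf := has_mean_section convex_f.
have hg i := has_mean_section (convex_g i).
have hL := has_meanD (has_meanB (hf _ (subXD Xx)) (hf _ (subXD Xxs)))
  (has_mean_sum (index_enum 'I_m) (fun i => has_meanZ (z i 0)
    (has_meanB (hg i _ (subXD Xx)) (hg i _ (subXD Xxs))))).
pose r := 1 + dot (x - xs) (x - xs)
  + dot (z - zs + c *: meanG x) (z - zs + c *: meanG x)
  + c ^+ 2 * (cG * dot (z - zs) (z - zs) + moment_bound).
have h := has_meanD (has_meanD (has_mean_cst P r) (has_meanZ (- (2 * c)) hL))
  (has_meanZ (c ^+ 2 * (1 + cG)) hB).
eexists; eexists; split; first exact: h.
- move=> o /=.
  have sub : f o x - f o xs + \sum_i z i 0 * (g i o x - g i o xs) <=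
      dot (direction o x z) (x - xs).
    rewrite /direction dotDl dot_suml; apply: lerD.
      have := oracle_f.1 o x Xx xs (subXD Xxs).
      by rewrite -[xs - x]opprB dotNr; lra.
    apply: ler_sum => i _; rewrite dotZl ler_wpM2l//.
    have := (oracle_g i).1 o x Xx xs (subXD Xxs).
    by rewrite -[xs - x]opprB dotNr; lra.
  have c20 := sqr_ge0 c.
  rewrite /half_step_energy /r.
  move: (dB o) sub; move: (direction o x z) (B o) => v Bo vB sub.
  have -> : x - c *: v - xs = (x - xs) - c *: v by rewrite addrAC.
  move: (x - xs) sub => y sub.
  have -> : dot (y - c *: v) (y - c *: v) = dot y y - 2 * c * dot v y + c ^+ 2 * dot v v.
    by rewrite !dotE (dotC y v); ring.
  have := ler_wpM2l (mulr_ge0 (ltW (ltr0Sn R 1)) (ltW c0)) sub.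
  have := ler_wpM2l (mulr_ge0 c20 (addr_ge0 ler01 cG0)) vB.
  move: (_ - _ + \sum_i _) (dot v y) (dot y y) (dot v v) (dot (_ + _) _) (dot _ _).
  by move=> p1 p2 p3 p4 p5 p6 h1 h2; move: h1 h2; rewrite !mulrDr !mulrDl; lra.
- have GG : dot (meanG x) (meanG x) <= moment_bound.
    apply: ler_sum => i _; rewrite mxE -expr2.
    exact: (constraint_moments i Xx).1.
  have E1 := energy_ge1 x z.
  (* The primal decrease L(x, z) - L(xs, z) and the dual term <z - zs, G(x)> combine exactly into
     the gap. *)
  have gapE : gap x z = (F x - F xs) + \sum_i z i 0 * (G i x - G i xs)
      - dot (z - zs) (meanG x).
    rewrite /gap /lagrangian dotDl dotNl.
    have -> : \sum_i z i 0 * (G i x - G i xs) = dot z (meanG x) - dot z (meanG xs).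
      by rewrite /dot -sumrB; apply: eq_bigr => i _; rewrite !mxE mulrBr.
    lra.
  have c20 := sqr_ge0 c.
  have h1 := ler_wpM2l (mulr_ge0 c20 (addr_ge0 ler01 cG0)) bc.
  have h2 := ler_wpM2l c20 GG.
  have h3 : c ^+ 2 * moment_bound <= c ^+ 2 * moment_bound * energy x z.
    by rewrite ler_peMr// mulr_ge0.
  have h4 : c ^+ 2 * cG * dot (z - zs) (z - zs) <= c ^+ 2 * cG * energy x z.
    by apply: ler_wpM2l; [rewrite mulr_ge0|rewrite /energy lerDr addr_ge0 ?dot_ge0].
  rewrite /r gapE /K.
  have -> : dot (z - zs + c *: meanG x) (z - zs + c *: meanG x) =
      dot (z - zs) (z - zs) + 2 * c * dot (z - zs) (meanG x)
      + c ^+ 2 * dot (meanG x) (meanG x).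
    by move: (z - zs) => a; rewrite !dotE (dotC _ a); ring.
  have EE : energy x z = 1 + dot (x - xs) (x - xs) + dot (z - zs) (z - zs) by [].
  move: (F x - F xs + \sum_i _) (dot (z - zs) (meanG x)) (dot (meanG x) _) h2 => A1 A2 A3 h2.
  move: (energy x z) (dot (x - xs) _) (dot (z - zs) _) EE h1 h3 h4 E1 bc => E A4 A5 EE h1 h3 h4 E1 bc.
  nra.
Qed.

(** * Measurability of the quantities attached to a random point *)

Section measurability.
Context {d0 : measure_display} {S : measurableType d0}.
Variables (o : S -> Om) (u : S -> 'cV[R]_n) (v : S -> 'cV[R]_m).
Hypotheses (mo : measurable_fun [set: S] o) (mu : measurable_coords u).
Hypotheses (mv : measurable_coords v) (Xu : forall s, X (u s)).

Lemma measurable_direction : measurable_coords (fun s => direction (o s) (u s) (v s)).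
Proof.
apply: measurable_coordsD => [j|].
  exact: (jointly_measurable_comp closedX (oracle_f.2 j) mo mu Xu).
apply: measurable_coords_sum => i; apply: measurable_coordsZ => // j.
exact: (jointly_measurable_comp closedX ((oracle_g i).2 j) mo mu Xu).
Qed.

Lemma measurable_constraint : measurable_coords (fun s => constraint (o s) (u s)).
Proof.
move=> i; under eq_fun do rewrite mxE.
exact: (jointly_measurable_comp closedX (@meas_g i) mo mu Xu).
Qed.

(** The mean constraint is Lipschitz on [X], where the points [u s] lie, and this suffices. *)
Lemma measurable_meanG : measurable_coords (fun s => meanG (u s)).
Proof.
move=> i; under eq_fun do rewrite mxE.
apply: (lipschitz_measurable (u := u) (L := C_G i)) => // s t.
exact: (mean_lipschitz closedX subXD (convex_g i) (oracle_g i)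
  (@bounded_G i) (@variance_G i)).
Qed.

Lemma measurable_energy : measurable_fun [set: S] (fun s => energy (u s) (v s)).
Proof.
apply: measurable_funD; first apply: measurable_funD => //;
  by apply: measurable_dot; apply: measurable_coordsB => //; exact: measurable_coords_cst.
Qed.

Lemma measurable_gap : measurable_fun [set: S] (fun s => gap (u s) (v s)).
Proof.
apply: measurable_funB; apply: measurable_funD => //.
- apply: (lipschitz_measurable (u := u) (L := C_F)) => // s t.
  exact: (mean_lipschitz closedX subXD convex_f oracle_f bounded_F variance_F).
- by apply: measurable_dot; [exact: measurable_coords_cst|exact: measurable_meanG].
- by apply: measurable_dot => //; exact: measurable_coords_cst.
Qed.

Lemma measurable_half_step_energy cG c :
  measurable_fun [set: S] (fun s => half_step_energy cG c (o s) (u s) (v s)).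
Proof.
have mvz : measurable_coords (fun s => v s - zs).
  by apply: measurable_coordsB => //; exact: measurable_coords_cst.
have md := measurable_direction.
have mxd : measurable_coords (fun s => u s - c *: direction (o s) (u s) (v s) - xs).
  apply: measurable_coordsB; last exact: measurable_coords_cst.
  by apply: measurable_coordsB => //; apply: measurable_coordsZ.
have mzG : measurable_coords (fun s => v s - zs + c *: meanG (u s)).
  by apply: measurable_coordsD => //; apply: measurable_coordsZ => //; exact: measurable_meanG.
apply: measurable_funD; last first.
  apply: measurable_funM => //; apply: measurable_funD => //.
  by apply: measurable_funM => //; apply: measurable_funD; exact: measurable_dot.
apply: measurable_funD; last exact: measurable_dot.
by apply: measurable_funD => //; exact: measurable_dot.
Qed.

End measurability.

(** * The random run of the method *)

Variables (gamma : nat -> R).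
Hypothesis gamma_gt0 : forall k, 0 < gamma k.
Context {d' : measure_display} {T : measurableType d'} (Q : probability T R).
Variables w w' : nat -> {RV Q >-> Om}.
Hypothesis iid : iid_samples P w w'.
Variables (x1 : 'cV[R]_n) (Xx1 : X x1).
Variables (x : nat -> T -> 'cV[R]_n) (z : nat -> T -> 'cV[R]_m).
Hypothesis run : forall t, primal_dual_run X g df dg gamma x1
     (fun k => w k t) (fun k => w' k t) (fun k => x k t) (fun k => z k t).

Local Notation past := (past_cylinders (sample w w')).
Local Notation pastT := (pastType (sample w w')).

Lemma sample_even k : sample w w' k.*2 = w k.
Proof. by rewrite /sample odd_double doubleK. Qed.

Lemma sample_odd k : sample w w' k.*2.+1 = w' k.
Proof. by rewrite /sample /= odd_double /= uphalf_double. Qed.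

Lemma Xx k t : X (x k t).
Proof.
by have [x0 _ /(_ k.-1)[[Xk _] _]] := run t; case: k Xk => // _; rewrite x0.
Qed.

Lemma z_ge0 k t : orthant (z k t).
Proof.
have [_ z0 /(_ k.-1)[_ [zk _]]] := run t; case: k zk => // _.
by rewrite z0 => i; rewrite mxE.
Qed.

Lemma primal_step k t : is_argmin X
  (fun y => dot (direction (w k t) (x k t) (z k t)) (y - x k t)
            + (2 * gamma k)^-1 * enorm (y - x k t) ^+ 2) (x k.+1 t).
Proof. by have [_ _ /(_ k)[]] := run t. Qed.

Lemma dual_step k t : is_argmin orthant
  (fun y => dot (- constraint (w' k t) (x k.+1 t)) (y - z k t)
            + (2 * gamma k)^-1 * enorm (y - z k t) ^+ 2) (z k.+1 t).
Proof. by have [_ _ /(_ k)[_ /is_argmax_argmin]] := run t. Qed.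

(** The iterates of index k depend on the 2k samples drawn before them; the primal update uses one
    more and the dual update another. Each update is nonexpansive in the measurable vector that it
    projects. *)
Lemma measurable_iterates_step k :
  measurable_coords (x k : pastT k.*2 -> _) -> measurable_coords (z k : pastT k.*2 -> _) ->
  measurable_coords (x k.+1 : pastT k.*2.+1 -> _) /\
  measurable_coords (z k.+1 : pastT k.+1.*2 -> _).
Proof.
move=> mx mz.
have mx1 : measurable_coords (x k : pastT k.*2.+1 -> _).
  by move=> j; apply: measurable_fun_past (mx j).
have mz1 : measurable_coords (z k : pastT k.*2.+1 -> _).
  by move=> j; apply: measurable_fun_past (mz j).
have mw : measurable_fun [set: pastT k.*2.+1] (w k : pastT k.*2.+1 -> Om).
  by rewrite -sample_even; exact: measurable_past_sample.
have mxS : measurable_coords (x k.+1 : pastT k.*2.+1 -> _).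
  move=> j; pose u t := x k t - gamma k *: direction (w k t) (x k t) (z k t).
  apply: (@lipschitz_measurable _ (pastT k.*2.+1) R n u _ 1).
    apply: measurable_coordsB => //; apply: measurable_coordsZ => //.
    exact: (measurable_direction mw mx1 mz1 (Xx k)).
  move=> s t; rewrite mul1r.
  have := prox_nonexpansive convexX (gamma_gt0 k) (primal_step k s) (primal_step k t).
  by apply: le_trans; have := coord_le_enorm (x k.+1 s - x k.+1 t) j; rewrite !mxE.
split=> // i; rewrite doubleS.
pose u t := z k t - gamma k *: - constraint (w' k t) (x k.+1 t).
apply: (@lipschitz_measurable _ (pastT k.*2.+2) R m u _ 1).
  apply: measurable_coordsB.
    by move=> j; apply: measurable_fun_past (mz j); rewrite leqW// leqW.
  apply: measurable_coordsZ => //; apply: measurable_coordsN.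
  apply: measurable_constraint => [|j|]; last exact: Xx.
    by rewrite -sample_odd; exact: measurable_past_sample.
  by apply: measurable_fun_past (mxS j).
move=> s t; rewrite mul1r.
have := prox_nonexpansive (@convex_orthant R m) (gamma_gt0 k) (dual_step k s) (dual_step k t).
by apply: le_trans; have := coord_le_enorm (z k.+1 s - z k.+1 t) i; rewrite !mxE.
Qed.

Lemma measurable_iterates k :
  measurable_coords (x k : pastT k.*2 -> _) /\ measurable_coords (z k : pastT k.*2 -> _).
Proof.
elim: k => [|k [mx mz]].
  have -> : x 0%N = (fun=> x1) by apply/funext => t; have [] := run t.
  have -> : z 0%N = (fun=> 0) by apply/funext => t; have [] := run t.
  by split; exact: measurable_coords_cst.
have [mxS mzS] := measurable_iterates_step mx mz; split=> // j.
by apply: measurable_fun_past (mxS j); rewrite doubleS.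
Qed.

Local Notation Y := (fun k t => energy (x k t) (z k t)).
Local Notation drift := (fun k t => 2 * gamma k * gap (x k t) (z k t)).

Let mx k : measurable_coords (x k).
Proof. by move=> j; apply: measurable_fun_of_past ((measurable_iterates k).1 j). Qed.

Let mz k : measurable_coords (z k).
Proof. by move=> j; apply: measurable_fun_of_past ((measurable_iterates k).2 j). Qed.

Let mY k : measurable_fun [set: T] (Y k).
Proof. exact: measurable_energy. Qed.

Let mdrift k : measurable_fun [set: T] (drift k).
Proof.
apply: measurable_funM => //.
exact: (measurable_gap (mx k) (mz k) (Xx k)).
Qed.

Let mw k : measurable_fun [set: T] (w k).
Proof. exact: measurable_funPT. Qed.

Let mw' k : measurable_fun [set: T] (w' k).
Proof. exact: measurable_funPT. Qed.

Lemma drift_ge0 k t : 0 <= drift k t.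
Proof.
apply: mulr_ge0; first by rewrite mulr_ge0// ltW.
exact: gap_ge0 (Xx k t) (z_ge0 k t).
Qed.

Lemma measurable_next_primal k : measurable_coords (x k.+1 : pastT k.*2.+1 -> _).
Proof. by have [h1 h2] := measurable_iterates k; have [] := measurable_iterates_step h1 h2. Qed.

Let mpast j (n0 : nat) (u : T -> 'cV[R]_n0) : measurable_coords (u : pastT j -> _) ->
  measurable_coords (fun p : pastT j * Om => u p.1).
Proof. by move=> mu i; exact: (measurableT_comp (mu i) measurable_fst). Qed.

Let mpastR j (u : T -> R) : measurable_fun [set: pastT j] (u : pastT j -> R) ->
  measurable_fun [set: pastT j * Om] (fun p : pastT j * Om => u p.1).
Proof. by move=> mu; exact: (measurableT_comp mu measurable_fst). Qed.

Let integral_weighted (c : R) (h : Om -> R) (B : Om -> R) (b y : R) : 0 <= c ->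
  measurable_fun [set: Om] h -> (forall o, 0 <= h o) ->
  has_mean P B b -> (forall o, h o <= B o) -> b <= y ->
  (\int[P]_o (c * h o)%:E <= (c * y)%:E)%E.
Proof.
move=> c0 mh h0 hB hBo b_y.
apply: (@le_trans _ _ (\int[P]_o (c * B o)%:E)%E).
  apply: ge0_le_integral => //.
  - by move=> o _; rewrite lee_fin mulr_ge0.
  - by apply/measurable_EFinP; exact: measurable_funM.
  - by apply: measurable_int (has_meanZ c hB).1.
  - by move=> o _; rewrite lee_fin ler_wpM2l.
by rewrite (has_mean_integral (has_meanZ c hB)) lee_fin ler_wpM2l.
Qed.

(** Plays the part of E[h | past] <= U: it is enough to bound the [P]-mean of [h t] for each frozen
    outcome t, through any dominating function. *)
Let past_sample_le j (phi U : T -> R) (h : T -> Om -> R) :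
  measurable_fun [set: pastT j] (phi : pastT j -> R) -> (forall t, 0 <= phi t) ->
  measurable_fun [set: pastT j * Om] ((fun p => h p.1 p.2) : pastT j * Om -> R) ->
  (forall t o, 0 <= h t o) -> measurable_fun [set: T] U ->
  (forall t, exists B b, [/\ has_mean P B b, forall o, h t o <= B o & b <= U t]) ->
  (\int[Q]_t (phi t * h t (sample w w' j t))%:E <= \int[Q]_t (phi t * U t)%:E)%E.
Proof.
move=> mphi phi0 mh h0 mU hU.
apply: (le_integral_past_sample (sample_independent iid)
  (phi := fun t o => phi t * h t o)).
- by apply: measurable_funM => //; exact: mpastR.
- by move=> t o; rewrite mulr_ge0.
- by apply: measurable_funM => //; exact: measurable_fun_of_past mphi.
move=> t; have [B [b [hB hBo bU]]] := hU t.
apply: integral_weighted hB hBo bU => //.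
exact: (@measurable_fun_pair2 _ _ _ (pastT j) Om _ (fun p => h p.1 p.2) t mh).
Qed.

Let measurable_at_sample j (h : T -> Om -> R) :
  measurable_fun [set: pastT j * Om] ((fun p => h p.1 p.2) : pastT j * Om -> R) ->
  measurable_fun [set: T] (fun t => h t (sample w w' j t)).
Proof.
move=> mh.
have mid : measurable_fun [set: T] (id : T -> pastT j).
  by move=> _ B mB; rewrite setTI; apply: measurable_past mB.
exact: (measurableT_comp mh (measurable_fun_pair mid (measurable_funPT (sample w w' j)))).
Qed.

(** Pointwise projection bounds alternate with averages, going back in time: the dual projection,
    the mean over the second sample given 2k+1 samples, the primal bound, and the mean over the
    first sample given 2k. *)
Lemma expected_descent : exists2 K, 0 <= K & forall k (phi : T -> R),
  measurable_fun [set: pastT k.*2] (phi : pastT k.*2 -> R) -> (forall t, 0 <= phi t) ->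
  (\int[Q]_t (phi t * Y k.+1 t)%:E + \int[Q]_t (phi t * drift k t)%:E <=
   \int[Q]_t (phi t * ((1 + K * gamma k ^+ 2) * Y k t))%:E)%E.
Proof.
have [cG cG0 cGP] := constraint_cross_term.
have [K K0 KP] := primal_expected_step cG0.
exists K => // k phi mphi phi0.
have g0 := gamma_gt0 k; set c := gamma k in g0 *.
have mphiT := measurable_fun_of_past mphi.
have mphi1 : measurable_fun [set: pastT k.*2.+1] (phi : pastT k.*2.+1 -> R).
  exact: measurable_fun_past mphi.
have [mxk mzk] := measurable_iterates k.
have mzk1 : measurable_coords (z k : pastT k.*2.+1 -> _).
  by move=> j; apply: measurable_fun_past (mzk j).
have mx1 := @measurable_next_primal k.
pose h1 t o := 1 + dot (x k.+1 t - xs) (x k.+1 t - xs) +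
  dot (z k t - zs + c *: constraint o (x k.+1 t)) (z k t - zs + c *: constraint o (x k.+1 t)).
pose U1 t := 1 + dot (x k.+1 t - xs) (x k.+1 t - xs) +
  (dot (z k t - zs) (z k t - zs) + 2 * c * dot (z k t - zs) (meanG (x k.+1 t))
   + c ^+ 2 * moment_bound).
pose h2 t o := half_step_energy cG c o (x k t) (z k t).
pose U2 t := (1 + K * c ^+ 2) * Y k t - drift k t.
have mh1 : measurable_fun [set: pastT k.*2.+1 * Om]
    ((fun p => h1 p.1 p.2) : pastT k.*2.+1 * Om -> R).
  have m1 := mpast mx1; have m2 := mpast mzk1.
  apply: measurable_funD; first apply: measurable_funD => //.
    by apply: measurable_dot; apply: measurable_coordsB => //; exact: measurable_coords_cst.
  have mc := measurable_constraint (measurable_snd : measurable_fun [set: pastT k.*2.+1 * Om] snd)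
    m1 (fun p => Xx k.+1 p.1).
  have mzc : measurable_coords (fun p : pastT k.*2.+1 * Om =>
      z k p.1 - zs + c *: constraint p.2 (x k.+1 p.1)).
    apply: measurable_coordsD; last by apply: measurable_coordsZ.
    by apply: measurable_coordsB => //; exact: measurable_coords_cst.
  exact: measurable_dot.
have mU1 : measurable_fun [set: T] U1.
  have mzs : measurable_coords (fun t => z k t - zs).
    by apply: measurable_coordsB => //; exact: measurable_coords_cst.
  have mxs : measurable_coords (fun t => x k.+1 t - xs).
    by apply: measurable_coordsB => //; exact: measurable_coords_cst.
  have mG := measurable_meanG (mx k.+1) (Xx k.+1).
  apply: measurable_funD; first by apply: measurable_funD => //; exact: measurable_dot.
  apply: measurable_funD => //; apply: measurable_funD; first exact: measurable_dot.
  by apply: measurable_funM => //; exact: measurable_dot.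
have mh2 : measurable_fun [set: pastT k.*2 * Om]
    ((fun p => h2 p.1 p.2) : pastT k.*2 * Om -> R).
  exact: (measurable_half_step_energy measurable_snd (mpast mxk) (mpast mzk)
    (fun p => Xx k p.1) cG c).
have mh2T : measurable_fun [set: T] (fun t => h2 t (w k t)).
  by rewrite -sample_even; exact: measurable_at_sample.
have mU2 : measurable_fun [set: T] U2.
  by apply: measurable_funB => //; apply: measurable_funM.
have h10 t o : 0 <= h1 t o by rewrite !addr_ge0 ?dot_ge0.
have hU1 t : exists B b, [/\ has_mean P B b, forall o, h1 t o <= B o & b <= U1 t].
  have [b hb bU] := dual_expected_step (z k t - zs) c (Xx k.+1 t).
  exists (h1 t), (1 + dot (x k.+1 t - xs) (x k.+1 t - xs) + b); split=> //.
    exact: (has_meanD (has_mean_cst P _) hb).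
  by rewrite lerD2l.
(* [U1] contains an inner product of either sign; it is nonnegative because it dominates the mean of
   a nonnegative function. *)
have U10 t : 0 <= U1 t.
  have [B [b [hB hBo]]] := hU1 t; apply: le_trans.
  apply: has_mean_le (has_mean_cst P 0) hB _ => o.
  exact: le_trans (hBo o).
have h20 t o : 0 <= h2 t o by exact: half_step_energy_ge0.
have hU2 t : exists B b, [/\ has_mean P B b, forall o, h2 t o <= B o & b <= U2 t].
  exact: (KP c (x k t) (z k t) g0 (Xx k t) (z_ge0 k t)).
have U20 t : 0 <= U2 t.
  have [B [b [hB hBo]]] := hU2 t; apply: le_trans.
  apply: has_mean_le (has_mean_cst P 0) hB _ => o.
  exact: le_trans (hBo o).
have Y0 t : 0 <= Y k.+1 t by rewrite (le_trans ler01)// energy_ge1.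
have step1 : (\int[Q]_t (phi t * Y k.+1 t)%:E <=
    \int[Q]_t (phi t * h1 t (sample w w' k.*2.+1 t))%:E)%E.
  rewrite sample_odd; apply: ge0_le_integral => //.
  - by move=> t _; rewrite lee_fin mulr_ge0.
  - by apply/measurable_EFinP; exact: measurable_funM.
  - apply/measurable_EFinP; apply: measurable_funM => //.
    by rewrite -sample_odd; exact: measurable_at_sample.
  move=> t _; rewrite lee_fin ler_wpM2l// /h1 /energy lerD2l.
  have := prox_dist (@convex_orthant R m) g0 (dual_step k t) (let: And3 _ h _ := saddle in h).
  by rewrite scalerN opprK addrAC.
have step2 := past_sample_le mphi1 phi0 mh1 h10 mU1 hU1.
have step3 : (\int[Q]_t (phi t * U1 t)%:E <=
    \int[Q]_t (phi t * h2 t (sample w w' k.*2 t))%:E)%E.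
  rewrite sample_even.
  have U1h t : U1 t <= h2 t (w k t).
    apply: (energy_half_step g0 cGP cG0 (Xx k t) (Xx k.+1 t)).
      apply: (prox_dist convexX g0 (primal_step k t)); exact: Xxs.
    exact: (prox_step convexX g0 (Xx k t) (primal_step k t)).
  apply: ge0_le_integral => //.
  - by move=> t _; rewrite lee_fin mulr_ge0.
  - by apply/measurable_EFinP; exact: measurable_funM.
  - by apply/measurable_EFinP; exact: measurable_funM.
  - by move=> t _; rewrite lee_fin ler_wpM2l.
have step4 := past_sample_le mphi phi0 mh2 h20 mU2 hU2.
have := le_trans (le_trans step1 step2) (le_trans step3 step4).
(* The drift is added on both sides; on the right it cancels under the integral sign, among real
   numbers, where infinite values cannot interfere. *)
move=> /(leeD2r (\int[Q]_t (phi t * drift k t)%:E)%E)/le_trans; apply.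
rewrite -ge0_integralD//; last 4 first.
- by move=> t _; rewrite lee_fin mulr_ge0.
- by apply/measurable_EFinP; exact: measurable_funM.
- by move=> t _; rewrite lee_fin mulr_ge0// drift_ge0.
- by apply/measurable_EFinP; exact: measurable_funM.
rewrite le_eqVlt; apply/orP; left; apply/eqP; apply: eq_integral => t _.
by rewrite -EFinD -mulrDr subrK.
Qed.

Local Notation noise := (fun k t =>
  dot (direction (w k t) (x k t) (z k t)) (direction (w k t) (x k t) (z k t)) +
  dot (constraint (w' k t) (x k.+1 t)) (constraint (w' k t) (x k.+1 t))).

Let mnoise_primal k : measurable_fun [set: T] (fun t =>
  dot (direction (w k t) (x k t) (z k t)) (direction (w k t) (x k t) (z k t))).
Proof. by apply: measurable_dot; exact: (measurable_direction (mw k) (mx k) (mz k) (Xx k)). Qed.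

Let mnoise_dual k : measurable_fun [set: T] (fun t =>
  dot (constraint (w' k t) (x k.+1 t)) (constraint (w' k t) (x k.+1 t))).
Proof. by apply: measurable_dot; exact: (measurable_constraint (mw' k) (mx k.+1) (Xx k.+1)). Qed.

Let Y_gt0 k t : 0 < Y k t.
Proof. by rewrite (lt_le_trans ltr01)// energy_ge1. Qed.

(** The direction is averaged given 2k samples and the constraint given 2k+1. The latter has a
    constant moment bound, which is at most that constant times the energy because the energy is at
    least 1. *)
Lemma expected_noise : exists2 K, 0 <= K & forall k (phi : T -> R),
  measurable_fun [set: pastT k.*2] (phi : pastT k.*2 -> R) -> (forall t, 0 <= phi t) ->
  (\int[Q]_t (phi t * noise k t)%:E <= \int[Q]_t (phi t * (K * Y k t))%:E)%E.
Proof.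
have [K K0 KP] := direction_moment.
have D20 := moment_bound_ge0.
exists (K + moment_bound); first exact: addr_ge0.
move=> k phi mphi phi0.
have mphiT := measurable_fun_of_past mphi.
have mphi1 : measurable_fun [set: pastT k.*2.+1] (phi : pastT k.*2.+1 -> R).
  exact: measurable_fun_past mphi.
have [mxk mzk] := measurable_iterates k.
have mx1 := @measurable_next_primal k.
have bprimal : (\int[Q]_t (phi t * dot (direction (sample w w' k.*2 t) (x k t) (z k t))
    (direction (sample w w' k.*2 t) (x k t) (z k t)))%:E <=
    \int[Q]_t (phi t * (K * Y k t))%:E)%E.
  apply: (past_sample_le mphi phi0
    (h := fun t o => dot (direction o (x k t) (z k t)) (direction o (x k t) (z k t)))).
  - by apply: measurable_dot; exact: (measurable_direction measurable_snd (mpast mxk)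
      (mpast mzk) (fun p => Xx k p.1)).
  - by move=> t o; exact: dot_ge0.
  - exact: measurable_funM.
  - by move=> t; exact: KP (Xx k t).
have bdual : (\int[Q]_t (phi t * dot (constraint (sample w w' k.*2.+1 t) (x k.+1 t))
    (constraint (sample w w' k.*2.+1 t) (x k.+1 t)))%:E <=
    \int[Q]_t (phi t * (moment_bound * Y k t))%:E)%E.
  apply: (past_sample_le mphi1 phi0
    (h := fun t o => dot (constraint o (x k.+1 t)) (constraint o (x k.+1 t)))).
  - by apply: measurable_dot; exact: (measurable_constraint measurable_snd (mpast mx1)
      (fun p => Xx k.+1 p.1)).
  - by move=> t o; exact: dot_ge0.
  - exact: measurable_funM.
  - move=> t; have [b hb bD] := constraint_second_moment (Xx k.+1 t).
    eexists; exists b; split; [exact: hb|by []|].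
    by rewrite (le_trans bD)// ler_peMr// energy_ge1.
move: bprimal bdual; rewrite sample_even sample_odd => bprimal bdual.
under eq_integral do rewrite mulrDr EFinD.
under [leRHS]eq_integral do rewrite mulrDl mulrDr EFinD.
rewrite ge0_integralD//; last 4 first.
- by move=> t _; rewrite lee_fin mulr_ge0// dot_ge0.
- by apply/measurable_EFinP; exact: measurable_funM.
- by move=> t _; rewrite lee_fin mulr_ge0// dot_ge0.
- by apply/measurable_EFinP; exact: measurable_funM.
rewrite ge0_integralD//; last 4 first.
- by move=> t _; rewrite lee_fin mulr_ge0// mulr_ge0// ltW.
- by apply/measurable_EFinP; apply: measurable_funM => //; exact: measurable_funM.
- by move=> t _; rewrite lee_fin mulr_ge0// mulr_ge0// ltW.
- by apply/measurable_EFinP; apply: measurable_funM => //; exact: measurable_funM.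
exact: leeD.
Qed.

(** * Almost sure bounds and convergence of the gap *)

Hypothesis gamma_sum : forall M : R, exists n, M < \sum_(k < n) gamma k.
Variable S : R.
Hypothesis gamma2_sum : forall n, \sum_(k < n) gamma k ^+ 2 <= S.

Lemma ae_energy_bounded_drift_summable :
  {ae Q, forall t, exists M, forall k, Y k t <= M} /\
  exists B : R, forall n, (\sum_(k < n) \int[Q]_t (drift k t)%:E <= B%:E)%E.
Proof.
have [K K0 KP] := expected_descent.
(* One step of the supermartingale consumes two samples, hence the filtration indexed by [k.*2]. The
   initial energy is deterministic, since the run starts from [x1] and 0. *)
apply: (@robbins_siegmund _ T R Q (fun k => past k.*2) Y drift
  (fun k => K * gamma k ^+ 2) (energy x1 0) (K * S)) => //.
- by move=> k E; exact: measurable_past.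
- move=> j k jk.
  have [mxj mzj] := measurable_iterates j.
  apply: (measurable_fun_past (j := j.*2)); first by rewrite leq_double.
  exact: measurable_energy.
- by move=> k t; exact: ltW.
- exact: drift_ge0.
- by move=> k; rewrite mulr_ge0// sqr_ge0.
- by move=> n0; rewrite -mulr_sumr ler_wpM2l.
- by move=> t; have [-> -> _] := run t.
Qed.

(** The denominator cancels the factor [Y k] in the noise bound: weight times K Y is K drift + K
    gamma^2, both summable in expectation. *)
Let weight k t := (drift k t + gamma k ^+ 2) / Y k t.

Let weight_ge0 k t : 0 <= weight k t.
Proof. by rewrite divr_ge0 ?(ltW (Y_gt0 k t))// addr_ge0 ?sqr_ge0 ?drift_ge0. Qed.

Let measurable_weight k : measurable_fun [set: pastT k.*2] (weight k : pastT k.*2 -> R).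
Proof.
have [mxk mzk] := measurable_iterates k.
apply: measurable_funM.
  apply: measurable_funD => //; apply: measurable_funM => //.
  exact: (measurable_gap mxk mzk (Xx k)).
(* For a positive base the inverse is the power of exponent -1, a measurable function of the
   base. *)
under eq_fun do rewrite -powR_inv1 ?(ltW (Y_gt0 k _))//.
exact: (measurableT_comp (measurable_powR (-1)) (measurable_energy mxk mzk)).
Qed.

Lemma ae_noise_summable : {ae Q, forall t, exists M : R, forall n,
  \sum_(k < n) (weight k t * noise k t + drift k t) <= M}.
Proof.
have [_ [B driftB]] := ae_energy_bounded_drift_summable.
have [K K0 KP] := expected_noise.
have mn k : measurable_fun [set: T] (noise k) by exact: measurable_funD.
have n0 k t : 0 <= noise k t by rewrite addr_ge0// dot_ge0.
have mwT k := measurable_fun_of_past (measurable_weight (k := k)).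
apply: (@ae_bounded_partial_sums _ _ _ Q
  (fun k t => weight k t * noise k t + drift k t) ((K + 1) * B + K * S)).
- by move=> k; apply: measurable_funD => //; exact: measurable_funM.
- by move=> k t; rewrite addr_ge0 ?drift_ge0// mulr_ge0.
(* The noise contributes K times the drift and K gamma^2, the drift itself the remaining 1 in K +
   1. *)
have bound k : (\int[Q]_t (weight k t * noise k t + drift k t)%:E <=
    (K + 1)%:E * \int[Q]_t (drift k t)%:E + (K * gamma k ^+ 2)%:E)%E.
  under eq_integral do rewrite EFinD.
  rewrite ge0_integralD//; last 4 first.
  - by move=> t _; rewrite lee_fin mulr_ge0.
  - by apply/measurable_EFinP; exact: measurable_funM.
  - by move=> t _; rewrite lee_fin drift_ge0.
  - exact/measurable_EFinP.
  rewrite (EFinD K 1) ge0_muleDl ?lee_fin// mul1e [leRHS]addeAC; apply: leeD => //.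
  apply: le_trans (KP k _ (measurable_weight (k := k)) (weight_ge0 k)) _.
  under eq_integral => t _.
    rewrite (_ : weight k t * _ = K * drift k t + K * gamma k ^+ 2); first over.
    by rewrite /weight mulrCA divfK ?gt_eqF// mulrDr.
  under eq_integral do rewrite EFinD EFinM.
  rewrite ge0_integralD//; last 3 first.
  - by move=> t _; rewrite -EFinM lee_fin mulr_ge0 ?drift_ge0.
  - by apply/measurable_EFinP; exact: measurable_funM.
  - by move=> t _; rewrite lee_fin mulr_ge0 ?sqr_ge0.
  rewrite ge0_integralZl//; last 2 first.
  - exact/measurable_EFinP.
  - by move=> t _; rewrite lee_fin drift_ge0.
  rewrite (_ : (\int[Q]_t (K * gamma k ^+ 2)%:E)%E = (K * gamma k ^+ 2)%:E)//.
  exact: (has_mean_integral (has_mean_cst Q _)).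
move=> n1; apply: (@le_trans _ _ (\sum_(k < n1)
    ((K + 1)%:E * \int[Q]_t (drift k t)%:E + (K * gamma k ^+ 2)%:E))%E).
  by apply: lee_sum => k _.
rewrite big_split /= sumEFin -mulr_sumr [leRHS]EFinD; apply: leeD; last first.
  by rewrite lee_fin; apply: ler_wpM2l => //; exact: gamma2_sum.
rewrite -ge0_sume_distrr; last first.
  by move=> k _; apply: integral_ge0 => t _; rewrite lee_fin drift_ge0.
by rewrite [leRHS]EFinM; apply: lee_wpmul2l; [rewrite lee_fin addr_ge0|exact: driftB].
Qed.

(** Outside a null set the rest is deterministic: [M] and [M'] depend on the path, and so does the
    constant multiplying the increment bounds. *)
Lemma ae_bounded_and_gap_cvg : {ae Q, forall t,
  (exists M, forall k, Y k t <= M) /\ (fun k => gap (x k t) (z k t)) @ \oo --> (0 : R)}.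
Proof.
have [L L0 LP] := gap_lipschitz.
have [bY _] := ae_energy_bounded_drift_summable.
apply: filterS2 bY ae_noise_summable => t [M YM] [M' noiseM]; split; first by exists M.
have gap0 k := gap_ge0 (Xx k t) (z_ge0 k t).
have wn0 k : 0 <= weight k t * noise k t.
  by rewrite mulr_ge0// addr_ge0// dot_ge0.
have M0 : 0 <= M by exact: le_trans (ltW (Y_gt0 0%N t)) (YM 0%N).
pose c := (L + 2 * L ^+ 2) * M.
have c0 : 0 <= c by rewrite mulr_ge0// addr_ge0// mulr_ge0// sqr_ge0.
apply: (@cvg0_of_summable_increments _ (fun k => gap (x k t) (z k t)) gamma
  (fun k => c * (weight k t * noise k t + drift k t)) M' (c * M')) => //.
- move=> n0; apply: le_trans (noiseM n0); apply: ler_sum => k _.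
  apply: (@le_trans _ _ (drift k t)); last by rewrite lerDr.
  by rewrite -mulrA ler_peMl ?ler1n// mulr_ge0// ltW.
- move=> k; rewrite /c /weight -!enorm_sqr.
  apply: sqr_increment_le; rewrite ?enorm_ge0 ?energy_ge1//.
  apply: le_trans (LP _ _ _ _ (Xx k t) (Xx k.+1 t)) _; apply: ler_wpM2l => //.
  apply: lerD.
    exact: (prox_step convexX (gamma_gt0 k) (Xx k t) (primal_step k t)).
  have := prox_step (@convex_orthant R m) (gamma_gt0 k) (z_ge0 k t) (dual_step k t).
  by rewrite /enorm dotNl dotNr opprK.
- by move=> n0; rewrite -mulr_sumr ler_wpM2l.
Qed.

End primal_dual_method.

(** * From extended-real series to the theorem *)

Lemma partial_sums_unbounded (R : realType) (u : nat -> R) :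
  (\sum_(0 <= k <oo) (u k)%:E = +oo)%E -> (forall k, 0 <= u k) ->
  forall M, exists n, M < \sum_(k < n) u k.
Proof.
move=> uoo u0 M; apply: contrapT => /forallNP uM.
suff : (\sum_(0 <= k <oo) (u k)%:E <= M%:E)%E by rewrite uoo leye_eq.
apply: lime_le; first by apply: is_cvg_nneseries => k _ _; rewrite lee_fin.
apply: nearW => n; rewrite sumEFin lee_fin big_mkord.
by rewrite leNgt; apply/negP.
Qed.

Lemma partial_sums_bounded (R : realType) (u : nat -> R) :
  (\sum_(0 <= k <oo) (u k)%:E < +oo)%E -> (forall k, 0 <= u k) ->
  exists S, forall n, \sum_(k < n) u k <= S.
Proof.
move=> uoo u0; exists (fine (\sum_(0 <= k <oo) (u k)%:E)%E) => n.
rewrite -lee_fin fineK; last first.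
  by rewrite ge0_fin_numE// nneseries_ge0// => k _ _; rewrite lee_fin.
rewrite -sumEFin -(big_mkord xpredT (fun k => (u k)%:E)).
by apply: nneseries_lim_ge => k _; rewrite lee_fin.
Qed.

Theorem proposition2p6 (R : realType) (n m : nat)
  (d : measure_display) (Om : measurableType d) (P : probability Om R)
  (D X : set 'cV[R]_n)
  (f : Om -> 'cV[R]_n -> R) (g : 'I_m -> Om -> 'cV[R]_n -> R)
  (df : Om -> 'cV[R]_n -> 'cV[R]_n) (dg : 'I_m -> Om -> 'cV[R]_n -> 'cV[R]_n)
  (closedX : closed X) (convexX : @convex_set R 'cV[R]_n X)
  (convexD : @convex_set R 'cV[R]_n D) (subXD : X `<=` D)
  (convex_f : random_convex P D f) (convex_g : forall i, random_convex P D (g i))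
  (meas_g : forall i, jointly_measurable X (g i))
  (oracle_f : subgradient_oracle D X f df)
  (oracle_g : forall i, subgradient_oracle D X (g i) (dg i))
  (C_F sigma_F : R) (C_G sigma_G D_G : 'I_m -> R)
  (bounded_F : forall x s, X x ->
     subdifferential D (mean P f) x s -> enorm s <= C_F)
  (bounded_G : forall i x s, X x ->
     subdifferential D (mean P (g i)) x s -> enorm s <= C_G i)
  (variance_F : forall x, X x -> variance_le P (df ^~ x) sigma_F)
  (variance_G : forall i x, X x -> variance_le P (dg i ^~ x) (sigma_G i))
  (moment_G : forall i x, X x ->
     ('E_P[fun w => (`|g i w x| ^+ 2)%R] <= (D_G i ^+ 2)%:E)%E)
  (xs : 'cV[R]_n) (zs : 'cV[R]_m)
  (saddle : saddle_point (mean P f) (fun i => mean P (g i)) X xs zs)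
  (gamma : nat -> R) (gamma_gt0 : forall k, 0 < gamma k)
  (gamma_sum : (\sum_(0 <= k <oo) (gamma k)%:E = +oo)%E)
  (gamma2_sum : (\sum_(0 <= k <oo) (gamma k ^+ 2)%:E < +oo)%E)
  (d' : measure_display) (T : measurableType d') (Q : probability T R)
  (w w' : nat -> {RV Q >-> Om}) (iid : iid_samples P w w')
  (x1 : 'cV[R]_n) (Xx1 : X x1)
  (x : nat -> T -> 'cV[R]_n) (z : nat -> T -> 'cV[R]_m)
  (run : forall t, primal_dual_run X g df dg gamma x1
     (fun k => w k t) (fun k => w' k t) (fun k => x k t) (fun k => z k t)) :
  {ae Q, forall t,
    (exists M : R, forall k, enorm (x k t) <= M /\ enorm (z k t) <= M) /\
    (fun k => lagrangian (mean P f) (fun i => mean P (g i)) (x k t) zs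
            - lagrangian (mean P f) (fun i => mean P (g i)) xs (z k t))
      @ \oo --> (0 : R)}.
Proof.
have gsum := partial_sums_unbounded gamma_sum (fun k => ltW (gamma_gt0 k)).
have [S g2sum] := partial_sums_bounded gamma2_sum (fun k => sqr_ge0 (gamma k)).
have := ae_bounded_and_gap_cvg closedX convexX subXD convex_f convex_g meas_g
  oracle_f oracle_g bounded_F bounded_G variance_F variance_G moment_G saddle
  gamma_gt0 iid Xx1 run gsum g2sum.
apply: filterS => t [[M YM] gap0]; split=> //.
(* Converts a bound on the squared distance to [s] into one on the norm, by |u| <= 1 + |u|^2 and
   |u|^2 <= 2 |u - s|^2 + 2 |s|^2. *)
have bound (l : nat) (u s : 'cV[R]_l) : dot (u - s) (u - s) <= M ->
    enorm u <= 1 + (2 * M + 2 * dot s s).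
  move=> usM; apply: le_trans (le_enorm_add1 u) _; rewrite lerD2l.
  have : 0 <= dot (u - s - s) (u - s - s) by exact: dot_ge0.
  by move: usM; rewrite !dotE !(dotC s u); lra.
(* The sum of the primal and dual bounds serves for both sequences, each being nonnegative because
   the energy bound M is at least 1. *)
exists (1 + (2 * M + 2 * dot xs xs) + (1 + (2 * M + 2 * dot zs zs))) => k.
have := YM k; rewrite /energy.
have dx := dot_ge0 (x k t - xs); have dz := dot_ge0 (z k t - zs) => YMk.
have := bound _ (x k t) xs; have := bound _ (z k t) zs.
have := dot_ge0 xs; have := dot_ge0 zs.
move=> s1 s2 bz bx; split; first by apply: le_trans (bx _) _; lra.
by apply: le_trans (bz _) _; lra.
Qed.
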